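(* If $L$ is a liftable-flexible group, then there exists a set $\Lambda$ of minimal quasimorphisms on $L$ such that $$\{[\rho]\in\mathrm{HQM}(L;\mathbb{Z}) : \rho\in\Lambda\}$$ is uncountable and ($\mathbb{Z}$-)linearly independent.
   Context: A projective representation of $L$ is a homomorphism $\rho\colon L\to \mathrm{PSL}_2(\mathbb{R})$; it is parabolic-free if $\rho(L)$ contains no nontrivial parabolic element, indiscrete if $\rho(L)$ is not discrete, and liftable if it factors through the universal covering $\widetilde{\mathrm{PSL}}_2(\mathbb{R})\to\mathrm{PSL}_2(\mathbb{R})$. Let $T_L$ be the set of torsion elements of $L$ (including the identity). A set $\Lambda\subseteq\mathrm{Hom}(L,\mathrm{PSL}_2(\mathbb{R}))$ is tracially disjoint if $\mathrm{tr}^2\circ\rho(L\setminus T_L)\cap\mathrm{tr}^2\circ\lambda(L\setminus T_L)=\varnothing$ for all distinct $\rho,\lambda\in\Lambda$. A finitely generated group $L$ is liftable-flexible if there exists an uncountable, tracially disjoint set of indiscrete faithful parabolic-free liftable projective representations of $L$. For $f\colon L\to\mathbb{Z}$ put $\partial f(g,h)=f(g)+f(h)-f(gh)$ and $D(f)=\sup|\partial f|$; $f$ is a quasimorphism if $D(f)<\infty$. A minimal quasimorphism is an integer-valued subadditive defect-one quasimorphism, i.e. a map $\alpha\colon L\to\mathbb{Z}$ which is not a homomorphism and satisfies $\alpha(g)+\alpha(h)-\alpha(gh)\in\{0,1\}$ for all $g,h\in L$. $\mathrm{HQM}(L;\mathbb{Z})$ is the abelian group of quasimorphisms $L\to\mathbb{Z}$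 modulo the subgroup generated by bounded maps $L\to\mathbb{Z}$ and homomorphisms $L\to\mathbb{Z}$. *)

(* Defs.v *)
From HB Require Import structures.
From mathcomp Require Import all_boot all_order all_algebra generic_quotient.
From mathcomp Require Import ring_quotient ring lra.
From mathcomp Require Import all_classical all_reals all_analysis.

Set Implicit Arguments.
Unset Strict Implicit.
Unset Printing Implicit Defensive.

Import Order.TTheory GRing.Theory Num.Theory.
Import numFieldNormedType.Exports.

Local Open Scope classical_set_scope.
Local Open Scope ring_scope.
Local Open Scope quotient_scope.

HB.mixin Record isTopologicalGroup G & Topological G & Group G := {
  mulg_continuous : continuous (fun x : G * G => (x.1 * x.2)%g);
  invg_continuous : continuous (fun x : G => (x^-1)%g)
}.

#[short(type="topologicalGroupType")]
HB.structure Definition TopologicalGroup :=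
  {G of Topological G & Group G & isTopologicalGroup G}.

Section path_homotopy.
Context {R : realType} {T : topologicalType}.
Implicit Types (f g h : R -> T) (H : R * R -> T).

(* A path is a function on all of R of which only the restriction to [0, 1]
   matters: paths that agree on [0, 1] are homotopic. *)
Definition is_path f := {within `[0%R, 1%R], continuous f}.

Definition path_homotopic f g := exists H,
  [/\ {within `[0%R, 1%R] `*` `[0%R, 1%R], continuous H},
      forall s : R, 0 <= s <= 1 -> H (s, 0) = f s /\ H (s, 1) = g s
    & forall t : R, 0 <= t <= 1 ->
        (H (0, t) = f 0 /\ H (0, t) = g 0) /\
        (H (1, t) = f 1 /\ H (1, t) = g 1)].

End path_homotopy.

Lemma within_continuous_precomp {X Y Z : topologicalType} (A : set X)
    (B : set Y) (h : X -> Y) (f : Y -> Z) :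
  continuous h -> (forall x, A x -> B (h x)) ->
  {within B, continuous f} -> {within A, continuous (f \o h)}.
Proof.
move=> ch AB /subspace_continuousP cf; apply/subspace_continuousP => x Ax.
apply: (@cvg_comp _ _ _ h f _ (within B (nbhs (h x)))); last exact/cf/AB.
move=> U /ch /=; rewrite /within /= !nbhs_simpl /=.
by apply: filterS => y /= + Ay; apply; exact: AB.
Qed.

Lemma within_continuous_pair {X Y Z W : topologicalType} (A : set X)
    (f : X -> Y) (g : X -> Z) (k : Y * Z -> W) :
  continuous k -> {within A, continuous f} -> {within A, continuous g} ->
  {within A, continuous (fun x => k (f x, g x))}.
Proof.
move=> ck /subspace_continuousP cf /subspace_continuousP cg.
apply/subspace_continuousP => x Ax.
apply: (@cvg_comp _ _ _ (fun x => (f x, g x)) k); last exact: ck.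
by apply: cvg_pair; [exact: cf|exact: cg].
Qed.

Lemma continuous_affine_snd (R : realType) (a b : R) :
  continuous (fun x : R * R => (x.1, a * x.2 + b)).
Proof.
move=> x; apply: (@cvg_pair _ _ _ (nbhs x) (nbhs x.1) (nbhs (a * x.2 + b))
  _ _ _ fst (fun x : R * R => a * x.2 + b)); first exact: cvg_fst.
by apply: cvgD; [apply: cvgM; [exact: cvg_cst|exact: cvg_snd]|exact: cvg_cst].
Qed.

Lemma closed_itvX (R : realType) (a b c d : R) :
  closed (`[a, b] `*` `[c, d] : set (R * R)).
Proof.
rewrite (_ : _ `*` _ = fst @^-1` [set` `[a, b]] `&` snd @^-1` [set` `[c, d]])//.
by apply: closedI; apply: preimage_closed => [x _|];
  [exact: cvg_fst|exact: itv_closed|exact: cvg_snd|exact: itv_closed].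
Qed.

Section path_homotopy_equiv.
Context {R : realType} {T : topologicalType}.
Implicit Types f g h : R -> T.

Lemma path_homotopic_refl f : is_path f -> path_homotopic f f.
Proof.
move=> cf; exists (f \o fst); split=> //.
by apply: within_continuous_precomp cf; [move=> x; exact: cvg_fst|move=> x []].
Qed.

Lemma path_homotopic_sym f g : path_homotopic f g -> path_homotopic g f.
Proof.
move=> [H [cH Hfg He]].
have I01 (t : R) : 0 <= t <= 1 -> 0 <= -1 * t + 1 <= 1.
  by move=> /andP[? ?]; apply/andP; split; lra.
exists (H \o (fun x => (x.1, -1 * x.2 + 1))); split.
- apply: within_continuous_precomp cH.
    exact: continuous_affine_snd.
  move=> [s t] [/=]; rewrite ?in_itv/= => s01 t01.
  by split=> //=; rewrite ?in_itv/=; exact: I01.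
- by move=> s s01 /=; rewrite mulr0 add0r mulr1 addNr; have [] := Hfg s s01.
- by move=> t t01; have [[? ?] [? ?]] := He _ (I01 _ t01).
Qed.

Lemma path_homotopic_trans f g h :
  path_homotopic f g -> path_homotopic g h -> path_homotopic f h.
Proof.
move=> [H [cH Hfg He]] [K [cK Kgh Ke]].
pose F (x : R * R) := if x.2 <= 2^-1 then H (x.1, 2 * x.2 + 0)
                      else K (x.1, 2 * x.2 + -1).
have E t : 0 <= t <= 1 ->
    (F (0, t) = f 0 /\ F (0, t) = h 0) /\ (F (1, t) = f 1 /\ F (1, t) = h 1).
  move=> /andP[t0 t1].
  have Z01 : 0 <= (0:R) <= 1 by rewrite lexx ler01.
  have [[f0 g0] [f1 g1]] := He _ Z01.
  have [[g0' h0] [g1' h1]] := Ke _ Z01.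
  rewrite /F /=; case: ifPn => [tle|]; last rewrite -ltNge => tgt.
    have /He[[-> _] [-> _]] : 0 <= 2 * t + 0 <= 1.
      by apply/andP; split; lra.
    by split; split=> //; congruence.
  have /Ke[[_ ->] [_ ->]] : 0 <= 2 * t + -1 <= 1.
    by apply/andP; split; lra.
  by split; split=> //; congruence.
exists F; split=> //; last first.
  move=> s s01; have [Hf Hg] := Hfg s s01; have [Kg Kh] := Kgh s s01.
  split; rewrite /F /=; first by rewrite ifT ?mulr0 ?addr0// invr_ge0.
  rewrite ifF; last by apply/negbTE; rewrite -ltNge; lra.
  by rewrite (_ : 2 * 1 - 1 = 1)//; lra.
pose A : set (R * R) := `[0%R, 1%R] `*` `[0%R, 2^-1].
pose B : set (R * R) := `[0%R, 1%R] `*` `[2^-1, 1%R].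
have -> : `[0%R, 1%R] `*` `[0%R, 1%R] = A `|` B.
  apply/seteqP; split=> [[s t]|[s t]]; rewrite /A /B /= !in_itv/=.
    move=> [s01 /andP[t0 t1]].
    by have [?|?] := leP t 2^-1; [left|right]; split=> //; apply/andP; split; lra.
  by move=> [] [s01 /andP[? ?]]; split=> //; apply/andP; split; lra.
have ceq (C : set (R * R)) (u v : R * R -> T) : {in C, u =1 v} ->
    {within C, continuous u} -> {within C, continuous v}.
  move=> uv; exact: subspace_eq_continuous.
apply: withinU_continuous.
- exact: closed_itvX.
- exact: closed_itvX.
- apply: (ceq _ (H \o (fun x => (x.1, 2 * x.2 + 0)))).
    move=> [s t]; rewrite inE /A /= ?in_itv/= => -[s01 /andP[t0 t1]].
    by rewrite /F /= t1.
  apply: within_continuous_precomp cH.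
    exact: continuous_affine_snd.
  move=> [s t]; rewrite /A /= ?in_itv/= => -[s01 /andP[? ?]].
  by split=> //; apply/andP; split; lra.
- apply: (ceq _ (K \o (fun x => (x.1, 2 * x.2 + -1)))).
    move=> [s t]; rewrite inE /B /= ?in_itv/= => -[s01 /andP[t0 t1]].
    rewrite /F /=; case: ifPn => // tle.
    have tE : t = 2^-1 by apply/eqP; rewrite eq_le tle t0.
    have -> : 2 * t + 0 = 1 by rewrite tE; lra.
    have -> : 2 * t + -1 = 0 by rewrite tE; lra.
    by have [-> _] := Kgh s s01; have [_ ->] := Hfg s s01.
  apply: within_continuous_precomp cK.
    exact: continuous_affine_snd.
  move=> [s t]; rewrite /B /= ?in_itv/= => -[s01 /andP[? ?]].
  by split=> //; apply/andP; split; lra.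
Qed.

End path_homotopy_equiv.

(* The universal covering group of a topological group G, as the group of
   homotopy classes with fixed endpoints of the paths starting at 1, with the
   pointwise product; the covering map is evaluation at the endpoint.  This is
   the universal covering group when G is connected, locally path-connected and
   semilocally simply connected.  Only its group structure is defined here. *)

Section universal_cover.
Context (R : realType) (G : topologicalGroupType).

Record based_path := BasedPath {
  based_path_fun :> R -> G;
  based_pathP : `[< is_path based_path_fun /\ based_path_fun 0 = 1%g >] }.

HB.instance Definition _ := [isSub for based_path_fun].
HB.instance Definition _ := [Choice of based_path by <:].

Implicit Types f g : based_path.

Lemma based_path_path f : is_path f.
Proof. by have /asboolP[] := based_pathP f. Qed.

Lemma based_path0 f : f 0 = 1%g.
Proof. by have /asboolP[] := based_pathP f. Qed.

Definition based_homotopic f g := `[< path_homotopic f g >].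

Lemma based_homotopic_equiv : equiv_class_of based_homotopic.
Proof.
split=> [f|f g|g f h].
- by apply/asboolP; apply: path_homotopic_refl; exact: based_path_path.
- by apply/asboolP/asboolP; exact: path_homotopic_sym.
- by move=> /asboolP fg /asboolP gh; apply/asboolP; exact: path_homotopic_trans fg gh.
Qed.

Canonical based_homotopic_equiv_rel := EquivRelPack based_homotopic_equiv.
Canonical based_homotopic_encModRel := defaultEncModRel based_homotopic.

Definition universal_cover := {eq_quot based_homotopic}.
HB.instance Definition _ := EqQuotient.on universal_cover.
HB.instance Definition _ := Choice.on universal_cover.

Lemma path1_subproof : `[< is_path (fun _ : R => 1%g : G) /\ (1 : G)%g = 1%g >].
Proof. by apply/asboolP; split=> //; apply: continuous_subspaceT => x; exact: cvg_cst. Qed.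
Definition path1 := BasedPath path1_subproof.

Lemma pathM_subproof f g :
  `[< is_path (fun s => f s * g s)%g /\ (f 0 * g 0)%g = 1%g >].
Proof.
apply/asboolP; split; last by rewrite !based_path0 mulg1.
by apply: (within_continuous_pair mulg_continuous); exact: based_path_path.
Qed.
Definition pathM f g := BasedPath (pathM_subproof f g).

Lemma pathV_subproof f : `[< is_path (fun s => (f s)^-1)%g /\ ((f 0)^-1)%g = 1%g >].
Proof.
apply/asboolP; split; last by rewrite !based_path0 invg1.
have /subspace_continuousP cf := @based_path_path f.
apply/subspace_continuousP => x Ax.
apply: cvg_comp; first exact: cf.
exact: invg_continuous.
Qed.
Definition pathV f := BasedPath (pathV_subproof f).

Definition uc1 : universal_cover := \pi_universal_cover path1.
Definition ucM (x y : universal_cover) : universal_cover :=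
  \pi_universal_cover (pathM (repr x) (repr y)).
Definition ucV (x : universal_cover) : universal_cover := \pi_universal_cover (pathV (repr x)).

Lemma pi_ucM f g : \pi_universal_cover (pathM f g) = ucM (\pi_universal_cover f) (\pi_universal_cover g).
Proof.
apply/eqmodP/asboolP.
have /eqmodP/asboolP[H [cH Hf He]] : f = repr (\pi_universal_cover f) %[mod universal_cover].
  by rewrite reprK.
have /eqmodP/asboolP[K [cK Kg Ke]] : g = repr (\pi_universal_cover g) %[mod universal_cover].
  by rewrite reprK.
exists (fun x => H x * K x)%g; split=> /=.
- exact: (within_continuous_pair mulg_continuous).
- by move=> s s01; have [-> ->] := Hf s s01; have [-> ->] := Kg s s01.
- move=> t t01; have [[a b] [c d]] := He t t01; have [[a' b'] [c' d']] := Ke t t01.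
  by split; split; [rewrite a a'|rewrite b b'|rewrite c c'|rewrite d d'].
Qed.

Lemma pi_ucV f : \pi_universal_cover (pathV f) = ucV (\pi_universal_cover f).
Proof.
apply/eqmodP/asboolP.
have /eqmodP/asboolP[H [cH Hf He]] : f = repr (\pi_universal_cover f) %[mod universal_cover].
  by rewrite reprK.
exists (fun x => (H x)^-1)%g; split=> /=.
- move/subspace_continuousP: cH => cH; apply/subspace_continuousP => x Ax.
  apply: cvg_comp; first exact: cH.
  exact: invg_continuous.
- by move=> s s01; have [-> ->] := Hf s s01.
- move=> t t01; have [[a b] [c d]] := He t t01.
  by split; split; [rewrite a|rewrite b|rewrite c|rewrite d].
Qed.

Lemma based_path_eq f g : f =1 g -> f = g.
Proof. by move=> /funext fg; apply: val_inj. Qed.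

Lemma ucA : associative ucM.
Proof.
elim/quotP=> f _; elim/quotP=> g _; elim/quotP=> h _.
rewrite -(pi_ucM g h) -(pi_ucM f g) -(pi_ucM f) -(pi_ucM _ h).
congr (\pi_universal_cover _).
by apply: based_path_eq => s /=; rewrite mulgA.
Qed.

Lemma uc1M : left_id uc1 ucM.
Proof.
move=> x; rewrite -[x]reprK -pi_ucM; congr (\pi_universal_cover _).
by apply: based_path_eq => s /=; rewrite mul1g.
Qed.

Lemma ucM1 : right_id uc1 ucM.
Proof.
move=> x; rewrite -[x]reprK -pi_ucM; congr (\pi_universal_cover _).
by apply: based_path_eq => s /=; rewrite mulg1.
Qed.

Lemma ucVM : left_inverse uc1 ucV ucM.
Proof.
move=> x; rewrite -[x]reprK -pi_ucV -pi_ucM; congr (\pi_universal_cover _).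
by apply: based_path_eq => s /=; rewrite mulVg.
Qed.

Lemma ucMV : right_inverse uc1 ucV ucM.
Proof.
move=> x; rewrite -[x]reprK -pi_ucV -pi_ucM; congr (\pi_universal_cover _).
by apply: based_path_eq => s /=; rewrite mulgV.
Qed.

HB.instance Definition _ := isGroup.Build universal_cover ucA uc1M ucM1 ucVM ucMV.

Definition cover_proj (x : universal_cover) : G := repr x 1.

Lemma cover_proj_pi f : cover_proj (\pi_universal_cover f) = f 1.
Proof.
rewrite /cover_proj.
have /eqmodP/asboolP[H [_ _ He]] : f = repr (\pi_universal_cover f) %[mod universal_cover].
  by rewrite reprK.
have [|_ [<- ->]//] := He 0.
by rewrite lexx ler01.
Qed.

Lemma cover_projM : {morph cover_proj : x y / (x * y)%g}.
Proof.
elim/quotP=> f _; elim/quotP=> g _.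
rewrite (_ : (_ * _)%g = \pi_universal_cover (pathM f g)); last by rewrite pi_ucM.
by rewrite !cover_proj_pi.
Qed.
HB.instance Definition _ :=
  isMultiplicative.Build universal_cover G cover_proj cover_projM.

End universal_cover.

Section SL2.
Context (R : realType).

Record SL2 := MkSL2 { SL2_val :> 'M[R]_2; SL2P : \det SL2_val == 1 }.

HB.instance Definition _ := [isSub for SL2_val].
HB.instance Definition _ := [Choice of SL2 by <:].
HB.instance Definition _ :=
  Topological.copy SL2 (initial_topology (SL2_val : SL2 -> 'M[R]_2)).

Implicit Types A B : SL2.

Lemma det_SL2 A : \det (A : 'M[R]_2) = 1.
Proof. exact/eqP/SL2P. Qed.

Lemma SL2_unit A : (A : 'M[R]_2) \in unitmx.
Proof. by rewrite unitmxE det_SL2 unitr1. Qed.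

Lemma SL2_1_subproof : \det (1%:M : 'M[R]_2) == 1.
Proof. by rewrite det1. Qed.
Definition SL2_1 := MkSL2 SL2_1_subproof.

Lemma SL2_mul_subproof A B : \det (A *m B) == 1.
Proof. by rewrite det_mulmx !det_SL2 mulr1. Qed.
Definition SL2_mul A B := MkSL2 (SL2_mul_subproof A B).

Lemma SL2_inv_subproof A : \det (invmx A) == 1.
Proof. by rewrite det_inv det_SL2 invr1. Qed.
Definition SL2_inv A := MkSL2 (SL2_inv_subproof A).

Lemma SL2_mulA : associative SL2_mul.
Proof. by move=> A B C; apply: val_inj; rewrite /= mulmxA. Qed.
Lemma SL2_mul1 : left_id SL2_1 SL2_mul.
Proof. by move=> A; apply: val_inj; rewrite /= mul1mx. Qed.
Lemma SL2_mulr1 : right_id SL2_1 SL2_mul.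
Proof. by move=> A; apply: val_inj; rewrite /= mulmx1. Qed.
Lemma SL2_mulV : left_inverse SL2_1 SL2_inv SL2_mul.
Proof. by move=> A; apply: val_inj; rewrite /= mulVmx ?SL2_unit. Qed.
Lemma SL2_mulrV : right_inverse SL2_1 SL2_inv SL2_mul.
Proof. by move=> A; apply: val_inj; rewrite /= mulmxV ?SL2_unit. Qed.

HB.instance Definition _ :=
  isGroup.Build SL2 SL2_mulA SL2_mul1 SL2_mulr1 SL2_mulV SL2_mulrV.

Lemma SL2_opp_subproof A : \det (- (A : 'M[R]_2)) == 1.
Proof. by rewrite -scaleN1r detZ sqrrN expr1n mul1r det_SL2. Qed.
Definition SL2_opp A := MkSL2 (SL2_opp_subproof A).

Lemma SL2_oppK : involutive SL2_opp.
Proof. by move=> A; apply: val_inj; rewrite /= opprK. Qed.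

Definition SL2_eqpm A B := (A == B) || (A == SL2_opp B).

Lemma SL2_eqpm_equiv : equiv_class_of SL2_eqpm.
Proof.
split=> [A|A B|B A C]; rewrite /SL2_eqpm.
- by rewrite eqxx.
- by rewrite [A == B]eq_sym -(inv_eq SL2_oppK) [SL2_opp A == B]eq_sym.
- case/orP=> /eqP-> /orP[] /eqP->; rewrite ?SL2_oppK ?eqxx ?orbT//.
Qed.

Canonical SL2_eqpm_equiv_rel := EquivRelPack SL2_eqpm_equiv.
Canonical SL2_eqpm_encModRel := defaultEncModRel SL2_eqpm.

Definition PSL2 := quotient_topology {eq_quot SL2_eqpm}.
HB.instance Definition _ := Quotient.on PSL2.
HB.instance Definition _ := Topological.on PSL2.

Implicit Types x y : PSL2.

Lemma eqPSL2P A B : reflect (A = B \/ A = SL2_opp B)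
  (\pi_PSL2 A == \pi_PSL2 B).
Proof.
by apply: (iffP eqP) => [/eqmodP/orP[]/eqP|AB]; [left|right|];
  rewrite //; apply/eqmodP/orP; case: AB => ->; [left|right].
Qed.

Lemma SL2_mulN A B : SL2_mul (SL2_opp A) B = SL2_opp (SL2_mul A B).
Proof. by apply: val_inj; rewrite /= mulNmx. Qed.

Lemma SL2_mulrN A B : SL2_mul A (SL2_opp B) = SL2_opp (SL2_mul A B).
Proof. by apply: val_inj; rewrite /= mulmxN. Qed.

Lemma SL2_invN A : SL2_inv (SL2_opp A) = SL2_opp (SL2_inv A).
Proof.
apply: val_inj; have N1 : (-1 : R) \is a GRing.unit by rewrite unitrN1.
rewrite /= -scaleN1r invmxZ ?unitmxZ ?SL2_unit//.
by rewrite invrN invr1 scaleN1r.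
Qed.

Lemma repr_PSL2 A : repr (\pi_PSL2 A) = A \/ repr (\pi_PSL2 A) = SL2_opp A.
Proof. by apply/eqPSL2P; rewrite reprK. Qed.

Definition PSL2_1 : PSL2 := \pi_PSL2 SL2_1.
Definition PSL2_mul x y : PSL2 := \pi_PSL2 (SL2_mul (repr x) (repr y)).
Definition PSL2_inv x : PSL2 := \pi_PSL2 (SL2_inv (repr x)).

Lemma pi_PSL2_mul A B :
  \pi_PSL2 (SL2_mul A B) = PSL2_mul (\pi_PSL2 A) (\pi_PSL2 B).
Proof.
apply/eqP/eqPSL2P; case: (repr_PSL2 A) => ->; case: (repr_PSL2 B) => ->;
  rewrite ?SL2_mulN ?SL2_mulrN ?SL2_oppK; by [left|right].
Qed.

Lemma pi_PSL2_inv A : \pi_PSL2 (SL2_inv A) = PSL2_inv (\pi_PSL2 A).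
Proof.
apply/eqP/eqPSL2P; case: (repr_PSL2 A) => ->;
  rewrite ?SL2_invN ?SL2_oppK; by [left|right].
Qed.

Lemma PSL2_mulA : associative PSL2_mul.
Proof.
elim/quotP=> A _; elim/quotP=> B _; elim/quotP=> C _.
by rewrite -(pi_PSL2_mul B C) -(pi_PSL2_mul A B) -(pi_PSL2_mul A)
  -(pi_PSL2_mul _ C) SL2_mulA.
Qed.

Lemma PSL2_1mul : left_id PSL2_1 PSL2_mul.
Proof. by elim/quotP=> A _; rewrite -(pi_PSL2_mul SL2_1 A) SL2_mul1. Qed.

Lemma PSL2_mul1 : right_id PSL2_1 PSL2_mul.
Proof. by elim/quotP=> A _; rewrite -(pi_PSL2_mul A SL2_1) SL2_mulr1. Qed.

Lemma PSL2_mulV : left_inverse PSL2_1 PSL2_inv PSL2_mul.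
Proof.
by elim/quotP=> A _; rewrite -(pi_PSL2_inv A) -(pi_PSL2_mul _ A) SL2_mulV.
Qed.

Lemma PSL2_mulrV : right_inverse PSL2_1 PSL2_inv PSL2_mul.
Proof.
by elim/quotP=> A _; rewrite -(pi_PSL2_inv A) -(pi_PSL2_mul A) SL2_mulrV.
Qed.

HB.instance Definition _ :=
  isGroup.Build PSL2 PSL2_mulA PSL2_1mul PSL2_mul1 PSL2_mulV PSL2_mulrV.

Lemma SL2_val_continuous : continuous (SL2_val : SL2 -> 'M[R]_2).
Proof. exact: (@initial_continuous SL2 'M[R]_2 SL2_val). Qed.

Lemma SL2_entry_continuous i j : continuous (fun A : SL2 => (A : 'M[R]_2) i j).
Proof.
move=> A; apply: (@continuous_comp _ _ _ SL2_val (fun M : 'M[R]_2 => M i j)).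
  exact: SL2_val_continuous.
exact: coord_continuous.
Qed.

Lemma continuous_to_SL2 (T : topologicalType) (f : T -> SL2) :
  (forall i j, continuous (fun t => (f t : 'M[R]_2) i j)) -> continuous f.
Proof.
move=> cf; apply: (@continuous_comp_initial SL2 T 'M[R]_2 SL2_val f) => t.
move=> U [P Pt PU]; rewrite /= nbhs_simpl /=.
have : \forall s \near t, forall i j, P i j ((f s : 'M[R]_2) i j).
  apply: filter_forall => i; apply: filter_forall => j.
  exact: (cf i j t _ (Pt i j)).
by apply: filterS => s Ps; exact: PU.
Qed.

Lemma SL2_mul_continuous : continuous (fun x : SL2 * SL2 => SL2_mul x.1 x.2).
Proof.
apply: continuous_to_SL2 => i j.
rewrite (_ : (fun _ => _) = fun x : SL2 * SL2 =>
  \sum_k (x.1 : 'M[R]_2) i k * (x.2 : 'M[R]_2) k j); last first.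
  by apply/funext => x; rewrite mxE.
move=> x.
have ck k : {for x, continuous (fun x : SL2 * SL2 =>
    (x.1 : 'M[R]_2) i k * (x.2 : 'M[R]_2) k j)}.
  apply: cvgM.
    by apply: (@continuous_comp _ _ _ fst (fun A : SL2 => (A : 'M[R]_2) i k));
      [exact: cvg_fst|exact: SL2_entry_continuous].
  by apply: (@continuous_comp _ _ _ snd (fun A : SL2 => (A : 'M[R]_2) k j));
    [exact: cvg_snd|exact: SL2_entry_continuous].
rewrite (_ : (fun _ => _) = fun x : SL2 * SL2 =>
  (x.1 : 'M[R]_2) i ord0 * (x.2 : 'M[R]_2) ord0 j +
  (x.1 : 'M[R]_2) i (lift ord0 ord0) * (x.2 : 'M[R]_2) (lift ord0 ord0) j).
  by apply: cvgD; exact: ck.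
by apply/funext => y; rewrite !big_ord_recl big_ord0 addr0.
Qed.

Lemma SL2_inv_continuous : continuous SL2_inv.
Proof.
apply: continuous_to_SL2 => i j.
rewrite (_ : (fun _ => _) = fun A : SL2 =>
  (-1) ^+ (j + i)%N * (A : 'M[R]_2) (lift j ord0) (lift i ord0)); last first.
  apply/funext => A; rewrite /= /invmx SL2_unit det_SL2 invr1 scale1r mxE.
  by rewrite /cofactor det_mx11 !mxE.
move=> A; apply: (@cvgM R SL2 (nbhs A) _ (fun=> (-1) ^+ (j + i)%N)
  (fun A : SL2 => (A : 'M[R]_2) (lift j ord0) (lift i ord0))).
  exact: cvg_cst.
exact: SL2_entry_continuous.
Qed.

Lemma SL2_opp_continuous : continuous SL2_opp.
Proof.
apply: continuous_to_SL2 => i j.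
rewrite (_ : (fun _ => _) = fun A : SL2 => - (A : 'M[R]_2) i j); last first.
  by apply/funext => A; rewrite mxE.
by move=> A; apply: continuousN; exact: SL2_entry_continuous.
Qed.

Lemma PSL2_pi_continuous : continuous (\pi_PSL2 : SL2 -> PSL2).
Proof. exact: pi_continuous. Qed.

Lemma PSL2_pi_open (U : set SL2) : open U -> open (\pi_PSL2 @` U : set PSL2).
Proof.
move=> oU; rewrite /open /= /quotient_open.
rewrite (_ : _ @^-1` _ = U `|` SL2_opp @^-1` U).
  apply: openU => //; move/continuousP: SL2_opp_continuous; exact.
apply/seteqP; split=> [A [B UB /eqP/eqPSL2P[<-|AB]]|A [UA|UA]].
- by left.
- by right; rewrite /= -AB.
- by exists A.
- by exists (SL2_opp A) => //; apply/eqP/eqPSL2P; right.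
Qed.

Lemma PSL2_pi_nbhs A (U : set SL2) :
  nbhs A U -> nbhs (\pi_PSL2 A : PSL2) (\pi_PSL2 @` U).
Proof.
rewrite nbhsE => -[V [oV VA] VU]; rewrite nbhsE; exists (\pi_PSL2 @` V).
  by split; [exact: PSL2_pi_open|exists A].
exact: image_subset.
Qed.

Lemma PSL2_mul_continuous : continuous (fun x : PSL2 * PSL2 => (x.1 * x.2)%g).
Proof.
case; elim/quotP=> A _; elim/quotP=> B _ U nU.
have {}nU : nbhs (\pi_PSL2 (SL2_mul A B) : PSL2) U by rewrite pi_PSL2_mul.
have /SL2_mul_continuous[[V W] /= [VA WB] VWU] :
  nbhs (SL2_mul (A, B).1 (A, B).2) (\pi_PSL2 @^-1` U).
  exact: PSL2_pi_continuous.
exists (\pi_PSL2 @` V, \pi_PSL2 @` W); first by split; exact: PSL2_pi_nbhs.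
move=> [_ _] [/= [a Va <-] [b Wb <-]]; rewrite (_ : (_ * _)%g = \pi_PSL2 (SL2_mul a b)); last by rewrite pi_PSL2_mul.
exact: (VWU (a, b)).
Qed.

Lemma PSL2_inv_continuous : continuous (fun x : PSL2 => (x^-1)%g).
Proof.
elim/quotP=> A _ U nU.
have {}nU : nbhs (\pi_PSL2 (SL2_inv A) : PSL2) U by rewrite pi_PSL2_inv.
have /SL2_inv_continuous nV : nbhs (SL2_inv A) (\pi_PSL2 @^-1` U).
  exact: PSL2_pi_continuous.
have := PSL2_pi_nbhs nV; apply: filterS => _ [a /= Va <-].
by rewrite /= (_ : (_^-1)%g = \pi_PSL2 (SL2_inv a))//; rewrite pi_PSL2_inv.
Qed.

HB.instance Definition _ :=
  isTopologicalGroup.Build PSL2 PSL2_mul_continuous PSL2_inv_continuous.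

(* The trace is defined up to sign, so its square does not depend on repr. *)
Definition tr2 x : R := (\tr (repr x : 'M[R]_2)) ^+ 2.

Lemma tr2_pi A : tr2 (\pi_PSL2 A) = (\tr (A : 'M[R]_2)) ^+ 2.
Proof.
by rewrite /tr2; case: (repr_PSL2 A) => -> //; rewrite /= linearN sqrrN.
Qed.

(* On purpose, the identity satisfies this. *)
Definition parabolic x := tr2 x = 4.

End SL2.

Definition discrete_subset (T : topologicalType) (A : set T) := A `<=` isolated A.

Definition torsion (L : groupType) : set L :=
  [set g | exists2 n, (0 < n)%N & (g ^+ n)%g = 1%g].

Definition finitely_generated (L : groupType) := exists s : seq L,
  forall H : groupClosed L, {subset s <= H} -> forall g, g \in H.

Section representations.
Context (R : realType) (L : groupType).
Implicit Types (rho : {multiplicative L -> PSL2 R}).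

Definition parabolic_free rho := forall g, parabolic (rho g) -> rho g = 1%g.

Definition indiscrete rho := ~ discrete_subset (range rho).

Definition liftable rho :=
  exists rho' : {multiplicative L -> universal_cover R (PSL2 R)},
    forall g, cover_proj (rho' g) = rho g.

Definition tracially_disjoint (Lambda : set {multiplicative L -> PSL2 R}) :=
  forall rho lambda, Lambda rho -> Lambda lambda -> rho <> lambda ->
    (fun g => tr2 (rho g)) @` (~` @torsion L) `&`
    (fun g => tr2 (lambda g)) @` (~` @torsion L) = set0.

Definition liftable_flexible := finitely_generated L /\
  exists Lambda : set {multiplicative L -> PSL2 R},
    [/\ ~ countable Lambda, tracially_disjoint Lambda &
        forall rho, Lambda rho ->
          [/\ indiscrete rho, injective rho, parabolic_free rho & liftable rho]].

End representations.

Section quasimorphisms.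
Context (L : groupType).
Implicit Types f : L -> int.

Definition coboundary f (g h : L) : int := f g + f h - f (g * h)%g.

Definition is_quasimorphism f :=
  exists D : int, forall g h, `|coboundary f g h| <= D.

Definition is_homomorphism f := forall g h, f (g * h)%g = f g + f h.

Definition is_bounded f := exists B : int, forall g, `|f g| <= B.

Definition minimal_quasimorphism f :=
  ~ is_homomorphism f /\
  forall g h, coboundary f g h = 0 \/ coboundary f g h = 1.

Definition quasimorphism_pred : {pred L -> int} :=
  fun f => `[< is_quasimorphism f >].

Lemma quasimorphism_zmod_closed : zmod_closed quasimorphism_pred.
Proof.
split=> [|f1 f2 /asboolP[D1 H1] /asboolP[D2 H2]]; apply/asboolP.
  by exists 0.
exists (D1 + D2) => g h.
rewrite (_ : coboundary _ _ _ = coboundary f1 g h - coboundary f2 g h).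
  by rewrite (le_trans (ler_normB _ _))// lerD.
rewrite /coboundary; have E x : (f1 - f2) x = f1 x - f2 x by [].
by rewrite !E; ring.
Qed.
HB.instance Definition _ :=
  GRing.isZmodClosed.Build (L -> int) quasimorphism_pred quasimorphism_zmod_closed.

Record QM := MkQM { QM_fun :> L -> int; QM_proof : QM_fun \in quasimorphism_pred }.

HB.instance Definition _ := [isSub for QM_fun].
HB.instance Definition _ := [Choice of QM by <:].
HB.instance Definition _ := [SubChoice_isSubZmodule of QM by <:].

(* The subgroup generated by bounded maps and homomorphisms, as the
   intersection of all the subgroups of QM containing them; bounded maps and
   homomorphisms are quasimorphisms, so ranging over QM loses none of them. *)
Definition trivial_QM : {pred QM} := fun f : QM =>
  `[< forall S : zmodClosed QM,
        (forall b : QM, is_bounded b -> b \in S) ->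
        (forall u : QM, is_homomorphism u -> u \in S) -> f \in S >].

Lemma trivial_QM_zmod_closed : zmod_closed trivial_QM.
Proof.
split=> [|f1 f2 /asboolP H1 /asboolP H2]; apply/asboolP => S Sb Su.
  exact: rpred0.
by apply: rpredB; [exact: H1|exact: H2].
Qed.
HB.instance Definition _ :=
  GRing.isZmodClosed.Build QM trivial_QM trivial_QM_zmod_closed.

Definition HQM := {ideal_quot trivial_QM}.
HB.instance Definition _ := GRing.Zmodule.on HQM.

Definition HQM_class (f : QM) : HQM := \pi_HQM f.

End quasimorphisms.

Definition Z_linearly_independent (V : zmodType) (A : set V) :=
  forall (s : seq V) (c : V -> int), uniq s -> (forall x, x \in s -> A x) ->
    \sum_(x <- s) x *~ c x = 0 -> forall x, x \in s -> c x = 0.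

(* Main.v *)
Require Import Defs.
From HB Require Import structures.
From mathcomp Require Import all_boot all_order all_algebra.
From mathcomp Require Import generic_quotient ring_quotient ring lra zify.
From mathcomp Require Import all_classical all_reals all_analysis.

Set Implicit Arguments.
Unset Strict Implicit.
Unset Printing Implicit Defensive.

Import Order.TTheory GRing.Theory Num.Theory.
Import numFieldNormedType.Exports.

Local Open Scope classical_set_scope.
Local Open Scope ring_scope.
Local Open Scope quotient_scope.

(** Every lift of a representation of L to the universal cover of PSL2(R) lets
    L act on the line above the projective circle, and the integer part
    (rounded up) of the displacement of the base point, in units of pi, is a quasimorphism
    whose coboundary takes the values 0 and 1 ([orbit_ceil_coboundary]).  Its
    homogenization is the translation number, which knows the trace: if the
    matrix of g is elliptic with translation number w (in radians), then the
    matrix of g^n has trace 2 cos(n w), while w is a multiple of pi if the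
    matrix is not elliptic ([rotation_elliptic], [rotation_nonelliptic]).
    Suppose that some multiple n of the classes of two such quasimorphisms
    agree.  Then n times the difference of the translation numbers is an
    integer-valued homomorphism, up to the factor pi; evaluated at an element
    that the first representation makes elliptic, this forces the two
    representations to share a squared trace on an element of infinite order,
    against tracial disjointness ([distinct_classes]).

    So, over an uncountable family of representations having elliptic
    elements, no two classes have equal nonzero multiples.  The classes
    themselves may well be dependent (already for rotation representations of
    the integers), so the family has to be thinned out: a maximal independent
    subset of the classes is uncountable, because the classes that depend on
    a countable set are countably many ([countable_fibers_independent]).

    It remains to treat a representation without elliptic elements.  Since it
    is indiscrete and parabolic-free, commutators [h, T] with T close to 1
    have to be trivial, by a trace computation ([commutes_near1]), and then
    all of L shares an eigenvector.  The logarithm of the eigenvalue is a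
    nonzero homomorphism lam from L to the reals, and the rounded multiples of
    lam form a family to which the same thinning out applies
    ([real_homomorphism_independent]).

    The action on the line is made explicit rather than obtained by lifting
    homeomorphisms.  For A in SL2(R) the vector (tr A, c - b) points in the
    direction of the rotation part of the polar decomposition of A.  It never
    vanishes, so its angle lifts along paths of PSL2(R), and the lifted angle
    is a function on the universal cover whose coboundary is smaller than
    pi/2 ([angle_defect]).  Because A turns every vector by less than pi/2
    away from its rotation part ([polar_act]), the lifted angle of the group
    element determines the lifted action on the line ([orbit_exists]). *)

(** * Angles *)

Section angles.
Context {R : realType}.
Implicit Types x y p q r : R.

Lemma sin_intmul_pi (k : int) : sin (k%:~R * pi) = 0 :> R.
Proof.
have nat_case (n : nat) : sin (n%:R * pi) = 0 :> R.
  elim: n => [|n IH]; first by rewrite mul0r sin0.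
  by rewrite -addn1 natrD mulrDl mul1r sinDpi IH oppr0.
case: k => n; first exact: nat_case.
by rewrite NegzE mulrNz mulNr sinN nat_case oppr0.
Qed.

Lemma sin_eq0 x : sin x = 0 -> exists k : int, x = k%:~R * pi.
Proof.
move=> sx0; pose k := Num.floor (x / pi); exists k.
have p0 : 0 < (pi : R) := pi_gt0 R.
have := floor_itv (x / pi).
rewrite -/k ler_pdivlMr// ltr_pdivrMr// => /andP[kx xk].
have : sin (x - k%:~R * pi) = 0.
  by rewrite sinB sx0 sin_intmul_pi; ring.
have := @sin_gt0_pi R (x - k%:~R * pi).
move: xk; rewrite intrD mulrDl mul1r => xk sg s0.
have [|xk0] := ltP 0 (x - k%:~R * pi); last by lra.
move=> x0; move: sg; rewrite s0 ltxx => sg.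
by have : false by apply: sg; lra.
Qed.

Lemma cos_eq1 x : cos x = 1 -> exists k : int, x = 2 * k%:~R * pi.
Proof.
move=> cx1; have /sin_eq0[k xk] : sin (x / 2) = 0.
  have := cos2Dsin2 (x / 2); have : cos (x / 2 + x / 2) = 1.
    by rewrite -[RHS]cx1; congr cos; lra.
  rewrite cosD => e1 e2; have /eqP : sin (x / 2) ^+ 2 = 0 by lra.
  by rewrite sqrf_eq0 => /eqP.
by exists k; lra.
Qed.

(** The recurrent way to control angles: an angle known up to an error below
    3 pi/2 whose cosine is positive lies in the central interval, since the
    cosine is not positive on the rest of the allowed range. *)
Lemma cos_gt0_pihalfP y : `|y| < 3 * pi / 2 -> 0 < cos y -> `|y| < pi / 2.
Proof.
have p0 : 0 < (pi : R) := pi_gt0 R.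
wlog y0 : y / 0 <= y.
  move=> h; have [y0|y0] := leP 0 y; first exact: h.
  by rewrite -normrN -cosN; apply: h; lra.
rewrite ger0_norm// => y3 cy; rewrite ltNge; apply/negP => yp.
have : 0 <= cos (y - pi) by apply: cos_ge0_pihalf; lra.
by rewrite cosB cospi sinpi; lra.
Qed.

Lemma angle_lt_2pi x : `|x| < 2 * pi -> cos x = 1 -> x = 0.
Proof.
move=> xl /cos_eq1[k xk]; move: xl.
have p0 : 0 < (pi : R) := pi_gt0 R.
rewrite xk -mulrA mulrCA [`|_|]normrM (gtr0_norm (x := 2 * pi)) ?mulr_gt0//.
rewrite -ltr_pdivlMr ?mulr_gt0// divff ?mulf_neq0 ?gt_eqF//.
rewrite -intr_norm (_ : 1 = 1%:~R)// ltr_int.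
case: k xk => [[|n]|n] _ //; by rewrite mul0r.
Qed.

Lemma polar_unit x y : x ^+ 2 + y ^+ 2 = 1 ->
  exists t, x = cos t /\ y = sin t.
Proof.
move=> h.
have x1 : -1 <= x <= 1.
  by rewrite -ler_norml -(@expr_le1 _ 2)// real_normK ?num_real//; nra.
have sE : sin (acos x) = `|y|.
  rewrite sin_acos// (_ : 1 - x ^+ 2 = y ^+ 2) ?sqrtr_sqr//; lra.
have [y0|y0] := leP 0 y.
  by exists (acos x); rewrite acosK ?in_itv//= sE ger0_norm.
by exists (- acos x); rewrite cosN acosK ?in_itv//= sinN sE ltr0_norm// opprK.
Qed.

Lemma cosB2intmul_pi y (m : int) : cos (y - 2 * m%:~R * pi) = cos y.
Proof.
have s0 := sin_intmul_pi m.
have := cos2Dsin2 (m%:~R * pi : R); rewrite s0 expr0n addr0 expr2 => c1.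
have -> : 2 * m%:~R * pi = m%:~R * pi + m%:~R * pi :> R by ring.
by rewrite cosB cosD sinD s0 c1; ring.
Qed.

Lemma sinB2intmul_pi y (m : int) : sin (y - 2 * m%:~R * pi) = sin y.
Proof.
have s0 := sin_intmul_pi m.
have := cos2Dsin2 (m%:~R * pi : R); rewrite s0 expr0n addr0 expr2 => c1.
have -> : 2 * m%:~R * pi = m%:~R * pi + m%:~R * pi :> R by ring.
by rewrite sinB cosD sinD s0 c1; ring.
Qed.

Lemma cos_gt0_reduce y : 0 < cos y -> exists m : int, `|y - 2 * m%:~R * pi| < pi / 2.
Proof.
move=> cy; have p0 : 0 < (pi : R) := pi_gt0 R.
(* The nearest multiple of 2 pi leaves a remainder of at most pi. *)
pose m := Num.floor (y / (2 * pi) + 2^-1); exists m.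
apply: cos_gt0_pihalfP; last by rewrite cosB2intmul_pi.
have := floor_itv (y / (2 * pi) + 2^-1); rewrite -/m intrD => /andP[].
have yE : y = y / (2 * pi) * (2 * pi) by rewrite divfK// mulf_neq0// gt_eqF.
set z := y / _ in yE * => m1 m2; rewrite yE ltr_norml; apply/andP; split; nra.
Qed.

Lemma cos_sqr_shift x (m : int) : cos (x + m%:~R * pi) ^+ 2 = cos x ^+ 2.
Proof.
have s0 := sin_intmul_pi m.
have := cos2Dsin2 (m%:~R * pi : R); rewrite s0 expr0n addr0 => c1.
by rewrite cosD s0 mulr0 subr0 exprMn c1 mulr1.
Qed.

Lemma same_direction x y (r s : R) : 0 < r -> 0 < s ->
  r * cos x = s * cos y -> r * sin x = s * sin y -> cos (x - y) = 1.
Proof.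
move=> r0 s0 c1 s1; have cx := cos2Dsin2 x; have cy := cos2Dsin2 y.
have rs : r ^+ 2 = s ^+ 2.
  rewrite -[LHS]mulr1 -[RHS]mulr1 -[in LHS]cx -cy.
  transitivity ((r * cos x) ^+ 2 + (r * sin x) ^+ 2); first by ring.
  by rewrite c1 s1; ring.
have {}rs : r = s by apply/eqP; rewrite -(@eqrXn2 _ 2)// ?ltW// rs.
move: c1 s1; rewrite rs => /(mulfI (lt0r_neq0 s0)) c1 /(mulfI (lt0r_neq0 s0)) s1.
by rewrite cosB c1 s1 -!expr2.
Qed.

(** Stretching the second axis moves a direction by less than pi/2: the inner
    product of (2 cos x, j sin x) with (cos x, sin x) is positive. *)
Lemma cos_gt0_stretch (j r x y : R) : 0 < j -> 0 < r ->
  2 * cos x = r * cos y -> j * sin x = r * sin y -> 0 < cos (y - x).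
Proof.
move=> j0 r0 c1 s1; rewrite -(pmulr_rgt0 _ r0) cosB mulrDr !mulrA -c1 -s1.
have := cos2Dsin2 x; rewrite -!mulrA -!expr2.
have := sqr_ge0 (cos x); have := sqr_ge0 (sin x).
set C := cos x ^+ 2; set S := sin x ^+ 2 => S0 C0 CS.
have [S1|S1] := ltP 0 S; first by have := mulr_gt0 j0 S1; lra.
have -> : C = 1 by lra.
have -> : S = 0 by lra.
by rewrite mulr0; lra.
Qed.

End angles.

(** * Lifting maps from the circle to the line *)

Lemma cvg_pair_to {T : Type} {U V : topologicalType} (F : set_system T)
    (f : T -> U) (g : T -> V) (a : U) (b : V) : Filter F ->
  f @ F --> a -> g @ F --> b -> (fun x => (f x, g x)) @ F --> (a, b).
Proof. by move=> FF fa gb; apply: (@cvg_pair _ _ _ F (nbhs a) (nbhs b)). Qed.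

Section lifting.
Context {R : realType}.
Implicit Types x y t : R.

(** The retraction of the line onto [0, 1], written with absolute values so
    that it is visibly continuous.  Composing with it turns continuity within
    [0, 1] into continuity on the whole line. *)
Definition clamp x : R := (`|x| - `|x - 1| + 1) / 2.

Lemma clamp_id x : 0 <= x <= 1 -> clamp x = x.
Proof.
by move=> /andP[x0 x1]; rewrite /clamp ger0_norm// ler0_norm; lra.
Qed.

Lemma clamp_itv x : 0 <= clamp x <= 1.
Proof.
rewrite /clamp; have [x0|x0] := ltP x 0.
  by rewrite ltr0_norm// ltr0_norm; lra.
have [x1|x1] := leP x 1.
  by rewrite ger0_norm// ler0_norm; lra.
by rewrite ger0_norm// ger0_norm; lra.
Qed.

Lemma clamp_continuous : continuous clamp.
Proof.
move=> x; apply: cvgM; last exact: cvg_cst.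
apply: cvgD; last exact: cvg_cst.
apply: cvgB; first by apply: cvg_norm; exact: cvg_id.
by apply: cvg_norm; apply: cvgB; [exact: cvg_id|exact: cvg_cst].
Qed.

(** Over the compact square, a map into the circle moves by less than a
    quarter turn when the second variable changes by a small step. *)
Lemma unit_step_positive (c s : R * R -> R) : continuous c -> continuous s ->
  (forall z, c z ^+ 2 + s z ^+ 2 = 1) ->
  exists2 N, (0 < N)%N & forall x t, 0 <= x <= 1 -> 0 <= t <= 1 ->
    0 < c (x, t) * c (x, t + N%:R^-1) + s (x, t) * s (x, t + N%:R^-1).
Proof.
move=> cc cs cs1.
pose K : set (R * R) := `[0, 1] `*` `[0, 1].
have cK : compact K by apply: compact_setX; exact: segment_compact.
pose F (d : R) (z : R * R) := c z * c (z.1, z.2 + d) + s z * s (z.1, z.2 + d).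
have cF (z : R * R) : (fun u : R * (R * R) => F u.1 u.2) u @[u --> (0, z)] -->
    F 0 z.
  have sh (f : R * R -> R) : continuous f ->
      f (u.2.1, u.2.2 + u.1) @[u --> ((0 : R), z)] --> f (z.1, z.2 + 0).
    move=> cf; apply: (@cvg_comp _ _ _ (fun u : R * (R * R) => (u.2.1, u.2.2 + u.1)) f _
      (nbhs (z.1, z.2 + 0))); last exact: cf.
    apply: cvg_pair_to => /=.
      by apply: cvg_comp; [exact: cvg_snd|exact: cvg_fst].
    apply: cvgD; last exact: cvg_fst.
    by apply: cvg_comp; [exact: cvg_snd|exact: cvg_snd].
  have un (f : R * R -> R) : continuous f ->
      f u.2 @[u --> ((0 : R), z)] --> f z.
    by move=> cf; apply: cvg_comp; [exact: cvg_snd|exact: cf].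
  by apply: cvgD; apply: cvgM; try exact: un; exact: sh.
have : \forall d \near (0 : R), K `<=` (fun z => 0 < F d z).
  move/compact_near_coveringP: cK => cK.
  apply: (cK R (nbhs (0 : R)) (fun d z => 0 < F d z)) => z Kz.
  have F0 : 0 < F 0 z.
    by rewrite /F addr0; case: (z) => x t; rewrite -!expr2 cs1.
  have := cvgr_gt _ (cF z) _ F0.
  move=> [[U V] /= [U0 Vz] UV]; exists (V, U) => //= -[z' d] [/= Vz' Ud].
  exact: (UV (d, z')).
move=> /nbhs_ballP[e /= e0 be].
pose N := (Num.truncn e^-1).+1.
exists N => // x t x01 t01.
have : ball (0 : R) e N%:R^-1.
  rewrite /ball /= sub0r normrN gtr0_norm ?invr_gt0 ?ltr0n//.
  rewrite invf_plt ?posrE ?ltr0n//.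
  exact: truncnS_gt.
move=> /be /(_ (x, t)); apply; rewrite /K /=; split; rewrite /= in_itv/=; by [].
Qed.

(** The angle of a point of the right half circle, as a formula continuous in
    the coordinates. *)
Lemma cos_sin_atan (c s : R) : 0 < c -> c ^+ 2 + s ^+ 2 = 1 ->
  cos (atan (s / c)) = c /\ sin (atan (s / c)) = s.
Proof.
move=> c0 cs1.
have cE : cos (atan (s / c)) = c.
  rewrite cos_atan (_ : 1 + _ = (c^-1) ^+ 2); last first.
    rewrite -[1 in LHS](@divff _ (c ^+ 2)) ?expf_neq0 ?gt_eqF//.
    by rewrite expr_div_n -mulrDl cs1 exprVn mul1r.
  by rewrite sqrtr_sqr gtr0_norm ?invr_gt0// invrK.
split=> //; have := atanK (s / c); rewrite /tan cE.
by move/(congr1 (fun z => z * c)); rewrite !divfK ?gt_eqF.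
Qed.

(** The total angle g x by which a homotopy of maps into the circle turns the
    point above x is continuous in x: it is the sum of the small angles of
    finitely many steps, each smaller than a quarter turn.  Both the existence
    of lifts of paths and their homotopy invariance are special cases. *)
Lemma homotopy_lift (c s : R * R -> R) : continuous c -> continuous s ->
  (forall z, c z ^+ 2 + s z ^+ 2 = 1) ->
  exists g : R -> R, [/\ continuous g,
    forall x, 0 <= x <= 1 ->
      c (x, 1) = c (x, 0) * cos (g x) - s (x, 0) * sin (g x) /\
      s (x, 1) = s (x, 0) * cos (g x) + c (x, 0) * sin (g x)
    & forall x, 0 <= x <= 1 ->
      (forall t, 0 <= t <= 1 -> c (x, t) = c (x, 0) /\ s (x, t) = s (x, 0)) ->
      g x = 0].
Proof.
move=> cc cs cs1; have [N N0 HN] := unit_step_positive cc cs cs1.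
have N0' : 0 < N%:R :> R by rewrite ltr0n.
suff /(_ N (leqnn N)) : forall k, (k <= N)%N ->
  exists g : R -> R, [/\ continuous g,
    forall x, 0 <= x <= 1 ->
      c (x, k%:R / N%:R) = c (x, 0) * cos (g x) - s (x, 0) * sin (g x) /\
      s (x, k%:R / N%:R) = s (x, 0) * cos (g x) + c (x, 0) * sin (g x)
    & forall x, 0 <= x <= 1 ->
      (forall t, 0 <= t <= 1 -> c (x, t) = c (x, 0) /\ s (x, t) = s (x, 0)) ->
      g x = 0].
  by rewrite divff ?gt_eqF.
elim=> [_|k IH kN].
  exists (fun=> 0); split=> [x|x _|//]; first exact: cvg_cst.
  by rewrite mul0r cos0 sin0 !mulr0 !mulr1 subr0 addr0.
have [g [cg gE g0]] := IH (ltnW kN).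
set t := k%:R / N%:R in gE; pose t' := t + N%:R^-1.
have t'E : k.+1%:R / N%:R = t' by rewrite /t' /t -addn1 natrD mulrDl div1r.
have t01 : 0 <= t <= 1.
  by rewrite /t divr_ge0// ler_pdivrMr// mul1r ler_nat ltnW.
have t'01 : 0 <= t' <= 1.
  by rewrite -t'E divr_ge0// ler_pdivrMr// mul1r ler_nat.
pose p x := c (x, t) * c (x, t') + s (x, t) * s (x, t').
pose q x := c (x, t) * s (x, t') - s (x, t) * c (x, t').
have pq1 x : p x ^+ 2 + q x ^+ 2 = 1.
  transitivity ((c (x, t) ^+ 2 + s (x, t) ^+ 2) * (c (x, t') ^+ 2 + s (x, t') ^+ 2)).
    by rewrite /p /q; ring.
  by rewrite !cs1 mulr1.
have p0 x : 0 <= x <= 1 -> 0 < p x by move=> x01; exact: HN.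
have cslice (f : R * R -> R) u : continuous f -> continuous (fun x => f (clamp x, u)).
  move=> cf x; apply: (@cvg_comp _ _ _ (fun x => (clamp x, u)) f); last exact: cf.
  by apply: cvg_pair_to; [exact: clamp_continuous|exact: cvg_cst].
exists (fun x => g x + atan (q (clamp x) / p (clamp x))); split.
- move=> x; apply: cvgD; first exact: cg.
  apply: (@cvg_comp _ _ _ (fun x => q (clamp x) / p (clamp x)) atan);
    last exact: continuous_atan.
  apply: cvgM.
    by apply: cvgB; apply: cvgM; exact: cslice.
  apply: cvgV; first by rewrite gt_eqF// p0// clamp_itv.
  by apply: cvgD; apply: cvgM; exact: cslice.
- move=> x x01; rewrite clamp_id// t'E.
  have [ca sa] := cos_sin_atan (p0 x x01) (pq1 x).
  have [gc gs] := gE x x01.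
  rewrite cosD sinD ca sa.
  have csx := cs1 (x, t).
  split.
    transitivity (c (x, t) * p x - s (x, t) * q x); last by rewrite gc gs; ring.
    by rewrite -[LHS]mul1r -csx /p /q; ring.
  transitivity (s (x, t) * p x + c (x, t) * q x); last by rewrite gc gs; ring.
  by rewrite -[LHS]mul1r -csx /p /q; ring.
- move=> x x01 h; rewrite clamp_id// g0// add0r.
  have [e1 e2] := h _ t01; have [e3 e4] := h _ t'01.
  suff -> : q x = 0 by rewrite mul0r atan0.
  by rewrite /q e1 e2 e3 e4; ring.
Qed.

(** The homotopy (x, t) -> (c, s)(x t) contracts the path to its origin. *)
Lemma path_lift (c s : R -> R) : continuous c -> continuous s ->
  (forall x, c x ^+ 2 + s x ^+ 2 = 1) -> c 0 = 1 -> s 0 = 0 ->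
  exists g : R -> R, [/\ continuous g, g 0 = 0 &
    forall x, 0 <= x <= 1 -> c x = cos (g x) /\ s x = sin (g x)].
Proof.
move=> cc cs cs1 c0 s0.
have cM (f : R -> R) : continuous f -> continuous (fun z : R * R => f (z.1 * z.2)).
  move=> cf z; apply: (@cvg_comp _ _ _ (fun z : R * R => z.1 * z.2) f); last exact: cf.
  by apply: cvgM; [exact: cvg_fst|exact: cvg_snd].
have [g [cg gE g0]] := homotopy_lift (cM _ cc) (cM _ cs) (fun z => cs1 (z.1 * z.2)).
exists g; split=> //.
  apply: g0 => [|t _]; first by rewrite lexx ler01.
  by rewrite /= !mul0r.
move=> x x01; have [] := gE x x01.
by rewrite /= !mulr1 !mulr0 c0 s0 !mul0r !mul1r subr0 add0r.
Qed.

(** Intermediate values: a continuous angle starting at 0 has to pass through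
    a zero of the cosine before it leaves the central interval. *)
Lemma cos_neq0_lt_pihalf (D : R -> R) : continuous D -> D 0 = 0 ->
  (forall x, 0 <= x <= 1 -> cos (D x) != 0) -> `|D 1| < pi / 2.
Proof.
move=> cD D0 Dn; rewrite ltNge; apply/negP => D1.
have p0 : 0 < (pi : R) := pi_gt0 R.
have nD : continuous (fun x => `|D x|) by move=> x; apply: cvg_norm; exact: cD.
have [] := @IVT R (fun x => `|D x|) 0 1 (pi / 2) ler01.
- exact: continuous_subspaceT.
- by rewrite D0 normr0 (min_idPl _) ?normr_ge0// (max_idPr _)// D1 divr_ge0// ltW.
move=> x; rewrite in_itv/= => x01 Dx.
by move: (Dn x x01); rewrite -cos_norm Dx cos_pihalf eqxx.
Qed.

Lemma lift_unique (g h : R -> R) : continuous g -> continuous h -> g 0 = h 0 ->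
  (forall x, 0 <= x <= 1 -> cos (g x) = cos (h x) /\ sin (g x) = sin (h x)) ->
  g 1 = h 1.
Proof.
move=> cg ch gh0 gh; apply/eqP; rewrite -subr_eq0; apply/eqP.
have p0 : 0 < (pi : R) := pi_gt0 R.
have c1 x : 0 <= x <= 1 -> cos (g x - h x) = 1.
  by move=> x01; have [ec es] := gh x x01; rewrite cosB ec es -!expr2 cos2Dsin2.
apply: angle_lt_2pi; last by apply: c1; rewrite ler01 lexx.
apply: (@lt_trans _ _ (pi / 2)); last by lra.
apply: (@cos_neq0_lt_pihalf (fun x => g x - h x)).
- by move=> x; apply: cvgB; [exact: cg|exact: ch].
- by rewrite gh0 subrr.
- by move=> x x01; rewrite c1// oner_neq0.
Qed.

Lemma lift_homotopy_invariant (c s : R * R -> R) (g h : R -> R) :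
  continuous c -> continuous s -> (forall z, c z ^+ 2 + s z ^+ 2 = 1) ->
  continuous g -> continuous h -> g 0 = h 0 ->
  (forall x, 0 <= x <= 1 -> c (x, 0) = cos (g x) /\ s (x, 0) = sin (g x)) ->
  (forall x, 0 <= x <= 1 -> c (x, 1) = cos (h x) /\ s (x, 1) = sin (h x)) ->
  (forall t, 0 <= t <= 1 -> c (0, t) = c (0, 0) /\ s (0, t) = s (0, 0)) ->
  (forall t, 0 <= t <= 1 -> c (1, t) = c (1, 0) /\ s (1, t) = s (1, 0)) ->
  g 1 = h 1.
Proof.
move=> cc cs cs1 cg ch gh0 gE hE e0 e1.
have [k [ck kE k0]] := homotopy_lift cc cs cs1.
rewrite -[LHS]addr0 -(k0 1 _ e1); last by rewrite ler01 lexx.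
apply: (@lift_unique (fun x => g x + k x) h) => //.
- by move=> x; apply: cvgD; [exact: cg|exact: ck].
- by rewrite (k0 0 _ e0) ?lexx ?ler01// addr0.
- move=> x x01; have [gc gs] := gE x x01; have [hc hs] := hE x x01.
  have [kc ks] := kE x x01.
  by rewrite cosD sinD -gc -gs -hc -hs kc ks; split=> //; ring.
Qed.

End lifting.

(** * The rotation part of a matrix of SL2(R) *)

Local Notation ma A := (SL2_val A 0 0).
Local Notation mb A := (SL2_val A 0 1).
Local Notation mc A := (SL2_val A 1 0).
Local Notation md A := (SL2_val A 1 1).

Section SL2_entries.
Context {R : realType}.
Implicit Types A B : SL2 R.

Lemma SL2_det A : ma A * md A - mb A * mc A = 1.
Proof.
rewrite -(det_SL2 A) (expand_det_row _ 0) !big_ord_recl big_ord0 /cofactor !det_mx11 !mxE.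
rewrite (_ : lift 0 0 = 1 :> 'I_2); last exact: val_inj.
rewrite (_ : lift 1 0 = 0 :> 'I_2); last exact: val_inj.
by rewrite /= expr0 expr1; ring.
Qed.

Lemma SL2_mulE A B i j : SL2_val (A * B)%g i j =
  SL2_val A i 0 * SL2_val B 0 j + SL2_val A i 1 * SL2_val B 1 j.
Proof.
rewrite mxE !big_ord_recl big_ord0 addr0.
by rewrite (_ : lift 0 0 = 1 :> 'I_2)//; exact: val_inj.
Qed.

Lemma SL2_oppE A i j : SL2_val (SL2_opp A) i j = - SL2_val A i j.
Proof. by rewrite mxE. Qed.

Lemma SL2_oneE : [/\ ma (1%g : SL2 R) = 1, mb (1%g : SL2 R) = 0,
  mc (1%g : SL2 R) = 0 & md (1%g : SL2 R) = 1].
Proof. by split; rewrite mxE. Qed.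

Lemma SL2_invE A : [/\ ma (A^-1)%g = md A, mb (A^-1)%g = - mb A,
  mc (A^-1)%g = - mc A & md (A^-1)%g = ma A].
Proof.
have [e11 e12 e21 e22] := SL2_oneE; have dA := SL2_det A.
have := mulVg A => h.
have := congr1 (fun B => ma B) h; have := congr1 (fun B => mb B) h.
have := congr1 (fun B => mc B) h; have := congr1 (fun B => md B) h.
rewrite !SL2_mulE e11 e12 e21 e22.
move: dA; set a := ma A; set b := mb A; set c := mc A; set d := md A.
move: (ma _) (mb _) (mc _) (md _) => w x y z dA h22 h21 h12 h11; split.
- transitivity (d * (w * a + x * c) - c * (w * b + x * d) ); last by rewrite h11 h12; ring.
  by rewrite -[LHS]mulr1 -dA; ring.
- transitivity (- b * (w * a + x * c) + a * (w * b + x * d)); last by rewrite h11 h12; ring.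
  by rewrite -[LHS]mulr1 -dA; ring.
- transitivity (d * (y * a + z * c) - c * (y * b + z * d)); last by rewrite h21 h22; ring.
  by rewrite -[LHS]mulr1 -dA; ring.
- transitivity (- b * (y * a + z * c) + a * (y * b + z * d)); last by rewrite h21 h22; ring.
  by rewrite -[LHS]mulr1 -dA; ring.
Qed.

Lemma SL2_trE A : \tr (SL2_val A) = ma A + md A.
Proof.
rewrite /mxtrace !big_ord_recl big_ord0 addr0.
by rewrite (_ : lift 0 0 = 1 :> 'I_2)//; exact: val_inj.
Qed.

Lemma pi_PSL2_eq A B : \pi_(PSL2 R) A = \pi_(PSL2 R) B -> A = B \/ A = SL2_opp B.
Proof. by move/eqP/eqPSL2P. Qed.

Definition tr A : R := ma A + md A.
(** The pair (tr A, skew A) is twice the complex number by which A acts on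
    the complex linear part of R^2 = C: writing A z = u z + v z*, one has
    2 u = tr A + i skew A, and |u|^2 - |v|^2 = det A = 1. *)
Definition skew A : R := mc A - mb A.

Lemma trN A : tr (SL2_opp A) = - tr A.
Proof. by rewrite /tr !SL2_oppE -opprD. Qed.

Lemma skewN A : skew (SL2_opp A) = - skew A.
Proof. by rewrite /skew !SL2_oppE -opprD. Qed.

Lemma tr_skew_split A :
  tr A ^+ 2 + skew A ^+ 2 = (ma A - md A) ^+ 2 + (mb A + mc A) ^+ 2 + 4.
Proof. by have := SL2_det A; rewrite /tr /skew => e; nra. Qed.

Lemma tr_skew_gt0 A : 0 < tr A ^+ 2 + skew A ^+ 2.
Proof. by rewrite tr_skew_split ltr_wpDl// addr_ge0// sqr_ge0. Qed.

(** A vector u perturbed by a shorter vector w still makes an acute angle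
    with u. *)
Lemma dominated_inner_gt0 (u1 u2 w1 w2 : R) : w1 ^+ 2 + w2 ^+ 2 < u1 ^+ 2 + u2 ^+ 2 ->
  0 < u1 * (u1 + w1) + u2 * (u2 + w2).
Proof.
move=> h; have := sqr_ge0 (u1 + w1); have := sqr_ge0 (u2 + w2); nra.
Qed.

Definition polar A (r t : R) := tr A = r * cos t /\ skew A = r * sin t.

(** Writing A z = u z + v z* and B z = u' z + v' z*, the complex linear part
    of A B is u u' + v v'^*, where the second term is the shorter one because
    |v| < |u| and |v'| < |u'|.  So the angle of A B is the sum of the angles
    of A and B up to an error below pi/2; the factors q, r and s keep track of
    the signs. *)
Lemma polar_mul A B (r s q a b c : R) : polar A r a -> polar B s b ->
  polar (A * B)%g q c -> 0 < q * r * s * cos (c - a - b).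
Proof.
move=> [xA yA] [xB yB] [xC yC].
have -> : q * r * s * cos (c - a - b) =
    (tr A * tr B - skew A * skew B) * tr (A * B)%g +
    (tr A * skew B + skew A * tr B) * skew (A * B)%g.
  by rewrite xA yA xB yB xC yC !cosB !sinB; ring.
pose p X : R := ma X - md X; pose n X : R := mb X + mc X.
pose u1 := tr A * tr B - skew A * skew B; pose u2 := tr A * skew B + skew A * tr B.
pose w1 := p A * p B + n A * n B; pose w2 := n A * p B - p A * n B.
have -> : (tr A * tr B - skew A * skew B) * tr (A * B)%g +
    (tr A * skew B + skew A * tr B) * skew (A * B)%g =
    (u1 * (u1 + w1) + u2 * (u2 + w2)) / 2.
  have -> : tr (A * B)%g = (u1 + w1) / 2.
    by rewrite /u1 /w1 /tr /skew /p /n !SL2_mulE; field.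
  have -> : skew (A * B)%g = (u2 + w2) / 2.
    by rewrite /u2 /w2 /tr /skew /p /n !SL2_mulE; field.
  by rewrite -/u1 -/u2; field.
rewrite divr_gt0//; apply: dominated_inner_gt0.
have -> : w1 ^+ 2 + w2 ^+ 2 = (p A ^+ 2 + n A ^+ 2) * (p B ^+ 2 + n B ^+ 2).
  by rewrite /w1 /w2; ring.
have -> : u1 ^+ 2 + u2 ^+ 2 = (tr A ^+ 2 + skew A ^+ 2) * (tr B ^+ 2 + skew B ^+ 2).
  by rewrite /u1 /u2; ring.
rewrite !tr_skew_split -/(p A) -/(p B) -/(n A) -/(n B).
have := sqr_ge0 (p A); have := sqr_ge0 (n A); have := sqr_ge0 (p B); have := sqr_ge0 (n B).
set a1 := p A ^+ 2; set a2 := n A ^+ 2; set b1 := p B ^+ 2; set b2 := n B ^+ 2.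
by move=> ? ? ? ?; nra.
Qed.

(** The cosine and the sine of twice the angle of A.  Doubling the angle makes
    it insensitive to the sign of A, hence well defined on PSL2(R). *)
Definition dbl_cos A : R := (tr A ^+ 2 - skew A ^+ 2) / (tr A ^+ 2 + skew A ^+ 2).
Definition dbl_sin A : R := (2 * tr A * skew A) / (tr A ^+ 2 + skew A ^+ 2).

Lemma dbl_cos_sin A : dbl_cos A ^+ 2 + dbl_sin A ^+ 2 = 1.
Proof.
rewrite /dbl_cos /dbl_sin; field; exact: lt0r_neq0 (tr_skew_gt0 A).
Qed.

Lemma dbl_cosN A : dbl_cos (SL2_opp A) = dbl_cos A.
Proof. by rewrite /dbl_cos trN skewN !sqrrN. Qed.

Lemma dbl_sinN A : dbl_sin (SL2_opp A) = dbl_sin A.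
Proof. by rewrite /dbl_sin trN skewN !sqrrN; congr (_ / _); ring. Qed.

Lemma dbl_cos1 : dbl_cos 1%g = 1.
Proof.
have [e11 e12 e21 e22] := SL2_oneE.
by rewrite /dbl_cos /tr /skew e11 e12 e21 e22; field.
Qed.

Lemma dbl_sin1 : dbl_sin 1%g = 0.
Proof.
have [e11 e12 e21 e22] := SL2_oneE.
by rewrite /dbl_sin /tr /skew e11 e12 e21 e22 subrr mulr0 mul0r.
Qed.

Lemma half_angle_polar A t : dbl_cos A = cos t -> dbl_sin A = sin t ->
  exists2 r, r != 0 & polar A r (t / 2).
Proof.
have := tr_skew_gt0 A; rewrite /polar /dbl_cos /dbl_sin; set x := tr A; set y := skew A.
set n := x ^+ 2 + y ^+ 2 => n0 ct st.
have nn0 : n != 0 by exact: lt0r_neq0.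
move: ct st; rewrite [in cos t](splitr t) cosD [in sin t](splitr t) sinD.
have := cos2Dsin2 (t / 2); set c := cos (t / 2); set s := sin (t / 2) => cs1.
move=> /(congr1 (fun z => z * n)); rewrite divfK// => ct.
move=> /(congr1 (fun z => z * n)); rewrite divfK// => st.
pose r := x * c + y * s.
have perp : y * c - x * s = 0.
  apply/eqP; rewrite -sqrf_eq0; apply/eqP.
  have -> : (y * c - x * s) ^+ 2 =
    (n * (c ^+ 2 + s ^+ 2) - (x ^+ 2 - y ^+ 2) * (c * c - s * s)
      - 2 * x * y * (s * c + c * s)) / 2.
    by rewrite /n; field.
  rewrite ct st cs1.
  have -> : (n * 1 - (c * c - s * s) * n * (c * c - s * s) -
    (s * c + c * s) * n * (s * c + c * s)) / 2 = n * (1 - (c ^+ 2 + s ^+ 2) ^+ 2) / 2.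
    by field.
  by rewrite cs1; field.
have xr : x = r * c.
  transitivity (r * c - s * (y * c - x * s)); last by rewrite perp; ring.
  by rewrite -[LHS]mulr1 -cs1 /r; ring.
have yr : y = r * s.
  transitivity (r * s + c * (y * c - x * s)); last by rewrite perp; ring.
  by rewrite -[LHS]mulr1 -cs1 /r; ring.
exists r => //; apply: contra_neq nn0 => r0.
by rewrite /n xr yr r0 !mul0r expr0n addr0.
Qed.

End SL2_entries.

(** * The angle function on the universal cover *)

Section cover_angle.
Context {R : realType}.
Local Notation E := (universal_cover R (PSL2 R)).
Implicit Types (f g : based_path R (PSL2 R)) (x y : E).

Lemma PSL2_invariant_continuous (F : SL2 R -> R) : continuous F ->
  (forall A, F (SL2_opp A) = F A) -> continuous (fun z : PSL2 R => F (repr z)).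
Proof.
move=> cF FN; apply: (@repr_comp_continuous _ _ _ F) => // A B.
by move/eqPSL2P => -[->//|->]; rewrite FN.
Qed.

Let tr_continuous : continuous (@tr R).
Proof. by move=> A; apply: continuousD; exact: SL2_entry_continuous. Qed.

Let skew_continuous : continuous (@skew R).
Proof. by move=> A; apply: continuousB; exact: SL2_entry_continuous. Qed.

Let norm_tr_skew_continuous : continuous (fun A : SL2 R => (tr A ^+ 2 + skew A ^+ 2)^-1).
Proof.
move=> A; apply: (@continuous_comp _ _ _ (fun A => tr A ^+ 2 + skew A ^+ 2) GRing.inv).
  by apply: continuousD; apply: continuousM;
    by [exact: tr_continuous|exact: skew_continuous].
by apply: inv_continuous; rewrite gt_eqF// tr_skew_gt0.
Qed.

Lemma dbl_cos_continuous : continuous (fun z : PSL2 R => dbl_cos (repr z)).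
Proof.
apply: PSL2_invariant_continuous => [A|A]; last exact: dbl_cosN.
apply: (@continuousM R (SL2 R) (fun A => tr A ^+ 2 - skew A ^+ 2) (fun A => (tr A ^+ 2 + skew A ^+ 2)^-1) A);
  last exact: norm_tr_skew_continuous.
by apply: continuousB; apply: continuousM; by [exact: tr_continuous|exact: skew_continuous].
Qed.

Lemma dbl_sin_continuous : continuous (fun z : PSL2 R => dbl_sin (repr z)).
Proof.
apply: PSL2_invariant_continuous => [A|A]; last exact: dbl_sinN.
apply: (@continuousM R (SL2 R) (fun A => 2 * tr A * skew A) (fun A => (tr A ^+ 2 + skew A ^+ 2)^-1) A);
  last exact: norm_tr_skew_continuous.
apply: continuousM; last exact: skew_continuous.
by apply: continuousM; [exact: cst_continuous|exact: tr_continuous].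
Qed.

Lemma dbl_cos_pi A : dbl_cos (repr (\pi_(PSL2 R) A)) = dbl_cos A.
Proof. by case: (repr_PSL2 A) => ->; rewrite ?dbl_cosN. Qed.

Lemma dbl_sin_pi A : dbl_sin (repr (\pi_(PSL2 R) A)) = dbl_sin A.
Proof. by case: (repr_PSL2 A) => ->; rewrite ?dbl_sinN. Qed.

Definition angle_lift f (phi : R -> R) := [/\ continuous phi, phi 0 = 0 &
  forall s, 0 <= s <= 1 ->
    dbl_cos (repr (f s)) = cos (phi s) /\ dbl_sin (repr (f s)) = sin (phi s)].

Lemma path_clamp_continuous f : continuous (fun s => f (clamp s)).
Proof.
apply/continuous_subspace_setT.
apply: (@within_continuous_precomp R R (PSL2 R) setT (`[0, 1] : set R) clamp f).
- exact: clamp_continuous.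
- by move=> s _; rewrite /= in_itv/=; exact: clamp_itv.
- exact: based_path_path.
Qed.

Lemma angle_lift_exists f : exists phi, angle_lift f phi.
Proof.
have z01 : 0 <= (0 : R) <= 1 by rewrite lexx ler01.
have [] := @path_lift R (fun s => dbl_cos (repr (f (clamp s))))
  (fun s => dbl_sin (repr (f (clamp s)))).
- move=> s; apply: (@continuous_comp _ _ _ (fun s => f (clamp s)) (fun z => dbl_cos (repr z))).
    exact: path_clamp_continuous.
  exact: dbl_cos_continuous.
- move=> s; apply: (@continuous_comp _ _ _ (fun s => f (clamp s)) (fun z => dbl_sin (repr z))).
    exact: path_clamp_continuous.
  exact: dbl_sin_continuous.
- by move=> s; exact: dbl_cos_sin.
- by rewrite clamp_id// based_path0 dbl_cos_pi dbl_cos1.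
- by rewrite clamp_id// based_path0 dbl_sin_pi dbl_sin1.
move=> phi [cphi phi0 phiE]; exists phi; split=> // s s01.
by have := phiE s s01; rewrite clamp_id.
Qed.

Lemma angle_lift_homotopic f g phi psi : path_homotopic f g ->
  angle_lift f phi -> angle_lift g psi -> phi 1 = psi 1.
Proof.
move=> [H [cH Hfg He]] [cphi phi0 phiE] [cpsi psi0 psiE].
have z01 : 0 <= (0 : R) <= 1 by rewrite lexx ler01.
have o01 : 0 <= (1 : R) <= 1 by rewrite lexx ler01.
pose K z := H (clamp z.1, clamp z.2).
have cK : continuous K.
  apply/continuous_subspace_setT.
  apply: (@within_continuous_precomp (R * R)%type (R * R)%type (PSL2 R) setT
    (`[0, 1] `*` `[0, 1] : set (R * R))
    (fun z : R * R => (clamp z.1, clamp z.2)) H) => //.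
    move=> z; apply: cvg_pair_to; apply: continuous_comp;
      by [exact: cvg_fst|exact: cvg_snd|exact: clamp_continuous].
  by move=> [s t] _; split; rewrite /= in_itv/=; exact: clamp_itv.
apply: (@lift_homotopy_invariant R (fun z => dbl_cos (repr (K z)))
    (fun z => dbl_sin (repr (K z))) phi psi) => //.
- move=> z; apply: (@continuous_comp _ _ _ K (fun z => dbl_cos (repr z))).
    exact: cK.
  exact: dbl_cos_continuous.
- move=> z; apply: (@continuous_comp _ _ _ K (fun z => dbl_sin (repr z))).
    exact: cK.
  exact: dbl_sin_continuous.
- by move=> z; exact: dbl_cos_sin.
- by rewrite phi0 psi0.
- move=> s s01; rewrite /K /= !clamp_id//.
  by have [-> _] := Hfg s s01; exact: phiE.
- move=> s s01; rewrite /K /= !clamp_id//.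
  by have [_ ->] := Hfg s s01; exact: psiE.
- move=> t t01; rewrite /K /= !clamp_id//.
  by have [[-> _] _] := He t t01; have [[-> _] _] := He 0 z01.
- move=> t t01; rewrite /K /= !clamp_id//.
  by have [_ [-> _]] := He t t01; have [_ [-> _]] := He 0 z01.
Qed.

Definition angle x : R := sval (cid (angle_lift_exists (repr x))) 1 / 2.

Lemma angle_pi f phi : angle_lift f phi -> angle (\pi_E f) = phi 1 / 2.
Proof.
move=> fphi; rewrite /angle; case: cid => psi /= hpsi; congr (_ / 2).
apply: angle_lift_homotopic hpsi fphi.
have /eqmodP/asboolP // : repr (\pi_E f) = f %[mod universal_cover R (PSL2 R)].
by rewrite reprK.
Qed.

Lemma angle_polar x :
  exists2 r, r != 0 & polar (repr (cover_proj x)) r (angle x).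
Proof.
elim/quotP: x => f _; have [phi [cphi phi0 phiE]] := angle_lift_exists f.
rewrite (@angle_pi f phi)// cover_proj_pi.
have [] := phiE 1; first by rewrite ler01 lexx.
exact: half_angle_polar.
Qed.

Lemma polarN A (r t : R) : polar A r t -> polar (SL2_opp A) (- r) t.
Proof. by move=> [hx hy]; split; rewrite ?trN ?skewN ?hx ?hy mulNr. Qed.

(** Along the product of two paths, the lifted angle of the product minus the
    two lifted angles starts at 0 and has a cosine that never vanishes by
    [polar_mul], so it stays below pi/2. *)
Lemma angle_defect x y : `|angle (x * y)%g - angle x - angle y| < pi / 2.
Proof.
elim/quotP: x => f _; elim/quotP: y => g _.
rewrite (_ : (_ * _)%g = \pi_E (pathM f g)); last by rewrite pi_ucM.
have [phi fphi] := angle_lift_exists f.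
have [psi gpsi] := angle_lift_exists g.
have [chi fgchi] := angle_lift_exists (pathM f g).
rewrite (angle_pi fphi) (angle_pi gpsi) (angle_pi fgchi).
case: fphi gpsi fgchi => [cphi phi0 phiE] [cpsi psi0 psiE] [cchi chi0 chiE].
have ch (u : R -> R) : continuous u -> continuous (fun s => u s / 2).
  by move=> cu s; apply: cvgM; [exact: cu|exact: cvg_cst].
apply: (@cos_neq0_lt_pihalf R (fun s => chi s / 2 - phi s / 2 - psi s / 2)).
- by move=> s; apply: cvgB; [apply: cvgB|]; exact: ch.
- by rewrite chi0 phi0 psi0; ring.
move=> s s01.
have [c1 s1] := phiE s s01; have [c2 s2] := psiE s s01; have [c3 s3] := chiE s s01.
have [r r0 fr] := half_angle_polar c1 s1.
have [r' r'0 gr] := half_angle_polar c2 s2.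
have [q q0 fgq] := half_angle_polar c3 s3.
have [q' q'0] : exists2 q', q' != 0 &
    polar (repr (f s) * repr (g s))%g q' (chi s / 2).
  have : polar (repr (\pi_(PSL2 R) (SL2_mul (repr (f s)) (repr (g s))))) q
    (chi s / 2) by exact: fgq.
  case: (repr_PSL2 (SL2_mul (repr (f s)) (repr (g s)))) => ->; first by exists q.
  by move=> /polarN; rewrite SL2_oppK; exists (- q); rewrite ?oppr_eq0.
by move=> /(polar_mul fr gr) h; apply: contraTneq h => ->; rewrite mulr0 ltxx.
Qed.

(** The image of x in SL2(R), the universal cover of PSL2(R) factoring
    through SL2(R): of the two matrices above the image of x in PSL2(R), it is
    the one whose rotation part has angle [angle x], and not [angle x] + pi. *)
Definition cover_mx x : SL2 R :=
  let A := repr (cover_proj x) in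
  if 0 < tr A * cos (angle x) + skew A * sin (angle x) then A else SL2_opp A.

Lemma pi_cover_mx x : \pi_(PSL2 R) (cover_mx x) = cover_proj x.
Proof.
rewrite /cover_mx; case: ifP => _; first by rewrite reprK.
rewrite -[RHS]reprK; apply/eqP/eqPSL2P; by right.
Qed.

Lemma cover_mx_polar x : exists2 r, 0 < r & polar (cover_mx x) r (angle x).
Proof.
have [r r0 Ar] := angle_polar x; rewrite /cover_mx.
set A := repr _ in Ar *.
have -> : tr A * cos (angle x) + skew A * sin (angle x) = r.
  have [-> ->] := Ar; rewrite -[RHS]mulr1 -(cos2Dsin2 (angle x)); ring.
case: ltP => rs; first by exists r.
exists (- r); last exact: polarN.
by rewrite oppr_gt0 lt_neqAle r0.
Qed.

Lemma cover_mxM x y : cover_mx (x * y)%g = (cover_mx x * cover_mx y)%g.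
Proof.
have : \pi_(PSL2 R) (cover_mx (x * y)%g) = \pi_(PSL2 R) (cover_mx x * cover_mx y)%g.
  rewrite pi_cover_mx cover_projM -(pi_cover_mx x) -(pi_cover_mx y).
  exact/esym/pi_PSL2_mul.
case/pi_PSL2_eq => // eN.
(* A wrong sign would put the angle of the product in the opposite half plane. *)
have [r r0 xr] := cover_mx_polar x; have [s s0 ys] := cover_mx_polar y.
have [q q0] := cover_mx_polar (x * y)%g; rewrite eN => /polarN.
rewrite SL2_oppK => /(polar_mul xr ys).
have := angle_defect x y; rewrite ltr_norml => /cos_gt0_pihalf c0.
by rewrite !mulNr oppr_gt0 ltNge !mulr_ge0// ltW.
Qed.

End cover_angle.

(** * Classes of quasimorphisms *)

Section trivial_quasimorphisms.
Context {L : groupType}.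
Implicit Types (f : QM L) (u : L -> int).

Definition near_homomorphism : {pred QM L} := fun f =>
  `[< exists2 u, is_homomorphism u & is_bounded (fun g => f g - u g) >].

Lemma near_homomorphism_zmod_closed : zmod_closed near_homomorphism.
Proof.
split=> [|f1 f2 /asboolP[u1 hu1 [B1 hB1]] /asboolP[u2 hu2 [B2 hB2]]]; apply/asboolP.
  by exists (fun=> 0) => [g h|]; [rewrite addr0|exists 0 => g; rewrite subr0 normr0].
exists (fun g => u1 g - u2 g) => [g h|]; first by rewrite hu1 hu2; ring.
exists (B1 + B2) => g; apply: (@le_trans _ _ (`|f1 g - u1 g| + `|f2 g - u2 g|)).
  rewrite (_ : _ - _ = (f1 g - u1 g) - (f2 g - u2 g)) ?ler_normB//.
  have -> : (f1 - f2) g = f1 g - f2 g by [].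
  by ring.
exact: lerD.
Qed.
HB.instance Definition _ :=
  GRing.isZmodClosed.Build (QM L) near_homomorphism near_homomorphism_zmod_closed.

(** Sums of a homomorphism and a bounded map already form a subgroup, so they
    exhaust the trivial quasimorphisms. *)
Lemma trivial_QM_near_homomorphism f : f \in @trivial_QM L -> f \in near_homomorphism.
Proof.
move=> /asboolP; apply.
  move=> b [B hB]; apply/asboolP; exists (fun=> 0) => [g h|]; first by rewrite addr0.
  by exists B => g; rewrite subr0.
move=> u hu; apply/asboolP; exists u => //.
by exists 0 => g; rewrite subrr normr0.
Qed.

Lemma HQM_class_eq_mulrz f1 f2 (n : int) : HQM_class f1 *~ n = HQM_class f2 *~ n ->
  exists2 u, is_homomorphism u &
    exists B : int, forall g, `|n * (f1 g - f2 g) - u g| <= B.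
Proof.
move=> e; have : (f1 *~ n - f2 *~ n) \in near_homomorphism.
  apply: trivial_QM_near_homomorphism; rewrite Quotient.idealrBE; apply/eqP.
  have pin f : \pi_(HQM L) (f *~ n) = HQM_class f *~ n by rewrite raddfMz.
  by rewrite !pin.
move=> /asboolP[u hu [B hB]]; exists u => //; exists B => g.
have E f : (f *~ n) g = n * f g.
  have nat_case k h : (f *+ k) h = k%:Z * f h.
    elim: k => [|k IH]; first by rewrite mul0r.
    have -> : (f *+ k.+1) h = f h + (f *+ k) h by rewrite mulrS.
    by rewrite IH; lia.
  case: n {e hB} => k; first exact: nat_case.
  have -> : (f *~ Negz k) g = - (f *+ k.+1) g by [].
  by rewrite nat_case NegzE mulNr.
have := hB g; have -> : (f1 *~ n - f2 *~ n) g = (f1 *~ n) g - (f2 *~ n) g by [].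
by rewrite !E mulrBr.
Qed.

End trivial_quasimorphisms.

(** * Extracting an independent subfamily *)

Section independent_subfamily.
Context {V : zmodType}.
Implicit Types A B : set V.

Lemma maximal_independent A : exists B, [/\ B `<=` A, Z_linearly_independent B &
  forall x, A x -> ~ B x -> ~ Z_linearly_independent (x |` B)].
Proof.
pose P : set (set V) := [set B | B `<=` A /\ Z_linearly_independent B].
have [F FP Ftot|B [[BA Bind] Bmax]] := @Zorn_bigcup V P.
  split; first by move=> x [X /FP[XA _]]; exact: XA.
  move=> s c us sF sum0 x xs.
  suff [X FX sX] : exists2 X, F X & forall y, y \in s -> X y.
    by have [_ /(_ s c us sX sum0 x xs)] := FP _ FX.
  have : s != [::] by case: (s) xs.
  elim: s {us xs sum0} sF => // y s IH sF _.
  have [X FX Xy] := sF y (mem_head _ _).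
  have [->|s0] := eqVneq s [::]; first by exists X => // z; rewrite mem_seq1 => /eqP->.
  have [|Y FY sY] := IH _ s0; first by move=> z zs; apply: sF; rewrite inE zs orbT.
  have [XY|YX] := Ftot _ _ FX FY.
    by exists Y => // z; rewrite inE => /orP[/eqP->|/sY//]; exact: XY.
  by exists X => // z; rewrite inE => /orP[/eqP->//|/sY]; exact: YX.
exists B; split=> // x Ax Bx xB; apply: (Bmax (x |` B)).
  split; last by move=> /(_ x) xBB; apply/Bx/xBB; left.
  by move=> y By; right.
by split=> // y [->//|/BA].
Qed.

Lemma dependent_relation B x : Z_linearly_independent B -> ~ B x ->
  ~ Z_linearly_independent (x |` B) ->
  exists (n : int) (s : seq V) (c : V -> int),
    [/\ n != 0, forall y, y \in s -> B y & x *~ n = \sum_(y <- s) y *~ c y].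
Proof.
move=> indB Bx nind.
have [[n [s [c [n0 sB e]]]]|H] :=
  pselect (exists (n : int) (s : seq V) (c : V -> int),
    [/\ n != 0, forall y, y \in s -> B y & x *~ n = \sum_(y <- s) y *~ c y]).
  by exists n, s, c.
exfalso; apply: nind => s c us sB sum0.
have remB y : y \in rem x s -> B y.
  rewrite mem_rem_uniq// inE => /andP[yx /sB[]// yE].
  by move: yx; rewrite yE eqxx.
have [xs|xs] := boolP (x \in s); last first.
  by apply: indB => // y ys; case: (sB y ys) => // yx; rewrite -yx ys in xs.
have split : \sum_(y <- s) y *~ c y = x *~ c x + \sum_(y <- rem x s) y *~ c y.
  by rewrite (perm_big _ (perm_to_rem xs)) big_cons.
have [cx0|cx0] := eqVneq (c x) 0.
  move: sum0; rewrite split cx0 mulr0z add0r => sum0 y ys.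
  have [->//|yx] := eqVneq y x.
  by apply: (indB _ c (rem_uniq x us) remB sum0); rewrite mem_rem_uniq// inE yx.
exfalso; apply: H; exists (- c x), (rem x s), c; split=> //; first by rewrite oppr_eq0.
by rewrite mulrNz; apply/esym/eqP; rewrite -addr_eq0 addrC -split sum0.
Qed.

(** Let B be a maximal independent set of values of a.  If B were countable,
    so would be the set of the pairs of an integer n <> 0 and an integral
    combination v of B.  By maximality each i satisfies a i *~ n = v for some
    such pair, and each pair serves only countably many i. *)
Lemma countable_fibers_independent (T : Type) (I : set T) (a : T -> V) :
  ~ countable I ->
  (forall (n : int) v, n != 0 -> countable [set i | I i /\ a i *~ n = v]) ->
  exists A, [/\ A `<=` a @` I, ~ countable A & Z_linearly_independent A].
Proof.
move=> ncI fibI; have [B [BI indB maxB]] := maximal_independent (a @` I).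
exists B; split=> // /countable_injP[f finj]; apply: ncI.
(* e enumerates B, and comb reads a list of indices with coefficients as an
   integral combination of B. *)
pose e (k : nat) : V := xget 0 [set y | B y /\ f y = k].
have eK y : B y -> e (f y) = y.
  move=> By; rewrite /e; case: xgetP => [z _ [Bz fz]|/(_ y)]; last by case.
  by apply: finj fz; rewrite inE.
pose comb (l : seq (nat * int)) : V := \sum_(p <- l) e p.1 *~ p.2.
pose fib (p : int * seq (nat * int)) : set T :=
  if p.1 == 0 then set0 else [set i | I i /\ a i *~ p.1 = comb p.2].
have : countable (\bigcup_(p in [set: int * seq (nat * int)]) fib p).
  apply: bigcup_countable => // p _; rewrite /fib.
  by case: eqVneq => [_|p0]; [exact: countable0|exact: fibI].
apply: sub_countable; apply: subset_card_le => i Ii.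
have [Bai|Bai] := pselect (B (a i)).
  exists (1, [:: (f (a i), 1)]) => //; rewrite /fib /=; split=> //.
  by rewrite /comb big_seq1 /= eK.
have [|n [s [c [n0 sB ein]]]] := dependent_relation indB Bai.
  by apply: maxB => //; exists i.
exists (n, [seq (f y, c y) | y <- s]) => //; rewrite /fib /= (negbTE n0); split=> //.
rewrite ein /comb big_map big_seq [RHS]big_seq.
by apply: eq_bigr => y ys /=; rewrite eK//; exact: sB.
Qed.

End independent_subfamily.

Lemma independent_HQM_classes (L : groupType) (T : Type) (I : set T) (al : T -> QM L) :
  ~ countable I -> (forall i, I i -> minimal_quasimorphism (al i)) ->
  (forall (n : int) v, n != 0 -> countable [set i | I i /\ HQM_class (al i) *~ n = v]) ->
  exists Lambda : set (QM L),
    [/\ forall rho, Lambda rho -> minimal_quasimorphism rho,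
        ~ countable [set HQM_class rho | rho in Lambda]
      & Z_linearly_independent [set HQM_class rho | rho in Lambda]].
Proof.
move=> ncI minI fibI.
have [A [AI ncA indA]] := countable_fibers_independent ncI fibI.
exists [set f | exists2 i, I i & f = al i /\ A (HQM_class (al i))].
rewrite (_ : [set HQM_class rho | rho in _] = A); last first.
  apply/seteqP; split=> [_ [_ [i Ii [-> Ai]] <-]//|v Av].
  have [i Ii iv] := AI v Av; exists (al i) => //.
  by exists i => //; rewrite iv.
by split=> // _ [i Ii [-> _]]; exact: minI.
Qed.

Lemma uncountable_real (R : realType) : ~ countable [set: R].
Proof.
move=> c; have c01 : countable (`[0, 1] : set R).
  by apply: sub_countable c; apply: subset_card_le.
have := countable_lebesgue_measure0 c01.
rewrite lebesgue_measure_itv/= lte_fin ltr01 oppr0 adde0 => /eqP.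
by rewrite eqe oner_eq0.
Qed.

(** * The lifted action on the line and translation numbers *)

Section SL2_action.
Context {R : realType}.
Implicit Types (A : SL2 R) (p q t : R).

(** With A z = u z + v z* as above, A z has an acute angle with u z because
    |v| < |u|. *)
Lemma polar_act A (r t p : R) : polar A r t ->
  0 < r * ((ma A * cos p + mb A * sin p) * cos (p + t) +
           (mc A * cos p + md A * sin p) * sin (p + t)).
Proof.
move=> [xA yA]; have cp := cos2Dsin2 p.
pose u1 := tr A * cos p - skew A * sin p; pose u2 := tr A * sin p + skew A * cos p.
pose w1 := (ma A - md A) * cos p + (mb A + mc A) * sin p.
pose w2 := (mb A + mc A) * cos p - (ma A - md A) * sin p.
have -> : r * ((ma A * cos p + mb A * sin p) * cos (p + t) +
           (mc A * cos p + md A * sin p) * sin (p + t)) =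
    (u1 * (u1 + w1) + u2 * (u2 + w2)) / 2.
  have -> : u1 + w1 = 2 * (ma A * cos p + mb A * sin p).
    by rewrite /u1 /w1 /tr /skew; ring.
  have -> : u2 + w2 = 2 * (mc A * cos p + md A * sin p).
    by rewrite /u2 /w2 /tr /skew; ring.
  by rewrite /u1 /u2 xA yA cosD sinD; field.
rewrite divr_gt0//; apply: dominated_inner_gt0.
have -> : w1 ^+ 2 + w2 ^+ 2 =
    ((ma A - md A) ^+ 2 + (mb A + mc A) ^+ 2) * (cos p ^+ 2 + sin p ^+ 2).
  by rewrite /w1 /w2; ring.
have -> : u1 ^+ 2 + u2 ^+ 2 = (tr A ^+ 2 + skew A ^+ 2) * (cos p ^+ 2 + sin p ^+ 2).
  by rewrite /u1 /u2; ring.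
by rewrite cp !mulr1 tr_skew_split; lra.
Qed.

Definition acts A p q := exists2 r, 0 < r &
  ma A * cos p + mb A * sin p = r * cos q /\
  mc A * cos p + md A * sin p = r * sin q.

Lemma acts_mul A B p q s : acts B p q -> acts A q s -> acts (A * B)%g p s.
Proof.
move=> [r r0 [B1 B2]] [r' r'0 [A1 A2]]; exists (r * r'); first exact: mulr_gt0.
split.
  transitivity (ma A * (ma B * cos p + mb B * sin p) +
      mb A * (mc B * cos p + md B * sin p)); first by rewrite !SL2_mulE; ring.
  rewrite B1 B2; transitivity (r * (ma A * cos q + mb A * sin q)); first by ring.
  by rewrite A1 mulrA.
transitivity (mc A * (ma B * cos p + mb B * sin p) +
    md A * (mc B * cos p + md B * sin p)); first by rewrite !SL2_mulE; ring.
rewrite B1 B2; transitivity (r * (mc A * cos q + md A * sin q)); first by ring.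
by rewrite A2 mulrA.
Qed.

Lemma acts_shift A p q : acts A p q -> acts A (p + pi) (q + pi).
Proof.
move=> [r r0 [A1 A2]]; exists r => //; rewrite !cosDpi !sinDpi !mulrN -!opprD.
by rewrite A1 A2.
Qed.

(** A preserves the area spanned by two vectors. *)
Lemma acts_sin A p q p' q' : acts A p p' -> acts A q q' ->
  exists2 r, 0 < r & r * sin (q' - p') = sin (q - p).
Proof.
move=> [r r0 [A1 A2]] [s s0 [B1 B2]]; exists (r * s); first exact: mulr_gt0.
rewrite !sinB.
transitivity ((r * cos p') * (s * sin q') - (r * sin p') * (s * cos q')); first by ring.
rewrite -A1 -A2 -B1 -B2 -[RHS]mul1r -(SL2_det A); ring.
Qed.

(** The discriminant of the characteristic polynomial is (tr A)^2 - 4. *)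
Lemma real_eigenvector A : 4 <= tr A ^+ 2 -> exists x y l : R,
  [/\ x ^+ 2 + y ^+ 2 != 0, l != 0, l + l^-1 = tr A,
    ma A * x + mb A * y = l * x & mc A * x + md A * y = l * y].
Proof.
rewrite /tr; have := SL2_det A; set a := ma A; set b := mb A; set c := mc A; set d := md A.
move=> det T4; pose l := (a + d + Num.sqrt ((a + d) ^+ 2 - 4)) / 2.
have lE : l ^+ 2 = (a + d) * l - 1.
  have : Num.sqrt ((a + d) ^+ 2 - 4) ^+ 2 = (a + d) ^+ 2 - 4.
    by rewrite sqr_sqrtr// subr_ge0.
  by rewrite /l; set s := Num.sqrt _ => e; nra.
have l0 : l != 0.
  by apply: contra_eq_neq lE => ->; rewrite expr0n mulr0 sub0r eq_sym oppr_eq0 oner_eq0.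
have lV : l + l^-1 = a + d.
  by apply: (mulfI l0); rewrite mulrDr divff// -expr2 lE; ring.
have char : (l - a) * (l - d) = b * c by lra.
have nz (x y : R) : (x != 0) || (y != 0) -> x ^+ 2 + y ^+ 2 != 0.
  by rewrite paddr_eq0 ?sqr_ge0// !sqrf_eq0 negb_and.
(* (b, l - a) is killed by the first row of A - l, and by the second one
   because det (A - l) = 0; if it is zero, the second row is used instead. *)
have [|] := boolP ((b != 0) || (l - a != 0)) => [h|].
  by exists b, (l - a), l; split=> //; [exact: nz|ring|lra].
rewrite negb_or !negbK => /andP[/eqP b0 /eqP la].
have [c0|c0] := eqVneq c 0.
  exists 1, 0, l; split=> //; first by lra.
  by rewrite c0; ring.
exists (l - d), c, l; split=> //; [by apply: nz; rewrite c0 orbT| |ring].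
by rewrite b0 mul0r addr0; congr (_ * _); lra.
Qed.

End SL2_action.

Lemma linear_bounded_eq0 (R : realType) (x C : R) : (forall n : nat, `|n%:R * x| <= C) -> x = 0.
Proof.
move=> h; apply/eqP; apply: contraT => x0.
have x0' : 0 < `|x| by rewrite normr_gt0.
have := truncnS_gt (C / `|x|); rewrite ltr_pdivrMr//.
by rewrite -[_.+1%:R]ger0_norm// -normrM ltNge h.
Qed.

Section group_morphisms.
Context {G H : groupType} {f : G -> H}.
Hypothesis fM : {morph f : x y / (x * y)%g}.

Lemma morph_group1 : f 1%g = 1%g.
Proof. by apply: (mulgI (f 1%g)); rewrite -fM !mulg1. Qed.

Lemma morph_groupV x : f (x^-1)%g = ((f x)^-1)%g.
Proof. by apply: (mulgI (f x)); rewrite -fM !mulgV morph_group1. Qed.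

Lemma morph_groupX x n : f (x ^+ n)%g = (f x ^+ n)%g.
Proof. by elim: n => [|n IH]; rewrite ?morph_group1// !expgS fM IH. Qed.

End group_morphisms.

(** What a homomorphism from L to the universal cover of PSL2(R) amounts to:
    its matrices in SL2(R), and a choice of their angles that is additive up
    to an error below pi/2. *)
Record polar_cocycle (R : realType) (L : groupType) (M : L -> SL2 R) (t : L -> R) := {
  cocycle_mx : forall g h, M (g * h)%g = (M g * M h)%g;
  cocycle_polar : forall g, exists2 r, 0 < r & polar (M g) r (t g);
  cocycle_defect : forall g h, `|t (g * h)%g - t g - t h| < pi / 2 }.

Section rotation.
Context {R : realType} {L : groupType} {M : L -> SL2 R} {t : L -> R}.
Hypothesis HM : polar_cocycle M t.
Implicit Types (g h : L) (p q : R).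

Let p0 : 0 < (pi : R) := pi_gt0 R.

(** q is the image of p under the lifted action of g: among the angles of the
    image of the vector (cos p, sin p), the one that is close to p + t g. *)
Let moves g p q := `|q - p - t g| < pi / 2 /\ acts (M g) p q.

(** By [polar_act] the image vector differs from the direction p + t g by an
    angle u below pi/2. *)
Lemma orbit_exists g p : exists q, moves g p q.
Proof.
have [r r0 Mr] := cocycle_polar HM g.
have := polar_act p Mr; rewrite pmulr_rgt0//.
set A := M g; set w1 := _ * cos p + _; set w2 := _ * cos p + _.
set e := p + t g; set i := w1 * cos e + w2 * sin e => i0.
pose k := w2 * cos e - w1 * sin e; pose u := atan (k / i).
have ub : `|u| < pi / 2 by rewrite ltr_norml atan_gtNpi2 atan_ltpi2.
have cu : 0 < cos u by apply: cos_gt0_pihalf; rewrite atan_gtNpi2 atan_ltpi2.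
have tu : sin u = k / i * cos u.
  by have := atanK (k / i); rewrite /tan -/u => <-; rewrite divfK// gt_eqF.
have ce := cos2Dsin2 e.
exists (e + u); split.
  by rewrite (_ : e + u - p - t g = u)// /e; ring.
exists (i / cos u); first exact: divr_gt0.
have cn : cos u != 0 by exact: lt0r_neq0.
have in0 : i != 0 by exact: lt0r_neq0.
rewrite cosD sinD tu; split.
  transitivity (i * cos e - k * sin e); last by field; rewrite cn in0.
  by rewrite -/w1 -[LHS]mulr1 -ce /i /k; ring.
transitivity (i * sin e + k * cos e); last by field; rewrite cn in0.
by rewrite -/w2 -[LHS]mulr1 -ce /i /k; ring.
Qed.

Definition orb g p : R := sval (cid (orbit_exists g p)).

Let orbP g p : moves g p (orb g p).
Proof. by rewrite /orb; case: cid. Qed.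

Lemma orb_near g p : `|orb g p - p - t g| < pi / 2.
Proof. by have [] := orbP g p. Qed.

Lemma orb_acts g p : acts (M g) p (orb g p).
Proof. by have [] := orbP g p. Qed.

Let moves_unique g p q : moves g p q -> orb g p = q.
Proof.
move=> [qn [r r0 [q1 q2]]]; have [qo [s s0 [k1 k2]]] := orbP g p.
apply/eqP; rewrite -subr_eq0; apply/eqP; apply: angle_lt_2pi.
  by move: qn qo; rewrite !ltr_norml => /andP[? ?] /andP[? ?]; apply/andP; split; lra.
by apply: (same_direction s0 r0); [rewrite -k1 -q1|rewrite -k2 -q2].
Qed.

(** Both sides are angles of the same vector, and they agree because the three
    errors below pi/2 add up to less than 3 pi/2. *)
Lemma orbM g h p : orb (g * h)%g p = orb g (orb h p).
Proof.
apply: moves_unique; have A : acts (M (g * h)%g) p (orb g (orb h p)).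
  by rewrite (cocycle_mx HM); apply: acts_mul; exact: orb_acts.
split=> //; apply: cos_gt0_pihalfP.
  have := orb_near h p; have := orb_near g (orb h p); have := cocycle_defect HM g h.
  rewrite !ltr_norml => /andP[? ?] /andP[? ?] /andP[? ?]; apply/andP; split; lra.
have [r r0 Mr] := cocycle_polar HM (g * h)%g.
have := polar_act p Mr; rewrite pmulr_rgt0//.
case: A => s s0 [e1 e2]; rewrite e1 e2 -!mulrA -mulrDr -cosB pmulr_rgt0//.
by rewrite opprD addrA.
Qed.

Let orb_pi g p : orb g (p + pi) = orb g p + pi.
Proof.
apply: moves_unique; split; last by apply: acts_shift; exact: orb_acts.
by have := orb_near g p; rewrite opprD addrACA subrr addr0.
Qed.

Lemma orb_shift g p (m : int) : orb g (p + m%:~R * pi) = orb g p + m%:~R * pi.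
Proof.
have nat_case n q : orb g (q + n%:R * pi) = orb g q + n%:R * pi.
  elim: n => [|n IH]; first by rewrite !mul0r !addr0.
  have addS x : x + n.+1%:R * pi = x + n%:R * pi + pi by rewrite -natr1; ring.
  by rewrite !addS orb_pi IH.
case: m => n; first exact: nat_case.
rewrite NegzE mulrNz mulNr; apply: (addIr (n.+1%:R * pi)).
by rewrite -nat_case !subrK.
Qed.

(** The action is increasing: the images of two independent vectors stay
    independent, with the same orientation. *)
Lemma orb_lt g p q : p < q < p + pi -> orb g p < orb g q < orb g p + pi.
Proof.
move=> /andP[pq qp]; have [r r0 rE] := acts_sin (orb_acts g p) (orb_acts g q).
have : 0 < sin (q - p) by apply: sin_gt0_pi; lra.
rewrite -rE pmulr_rgt0//; set z := orb g q - orb g p => sz.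
have zb : - pi < z < 2 * pi.
  have := orb_near g p; have := orb_near g q; rewrite !ltr_norml /z.
  by move=> /andP[? ?] /andP[? ?]; apply/andP; split; lra.
suff : 0 < z < pi by rewrite /z => /andP[? ?]; apply/andP; split; lra.
move: zb => /andP[z1 z2].
have [z0|z0] := ltP 0 z; last first.
  have : 0 <= sin (- z) by apply: sin_ge0_pi; lra.
  by rewrite sinN; lra.
have [//|zp] := ltP z pi.
have : 0 <= sin (z - pi) by apply: sin_ge0_pi; lra.
by rewrite sinB cospi sinpi; lra.
Qed.

Definition orbit_ceil g : int := Num.ceil (orb g 0 / pi).

Lemma orbit_ceil_itv g :
  ((orbit_ceil g)%:~R - 1) * pi < orb g 0 <= (orbit_ceil g)%:~R * pi.
Proof.
have := ceil_itv (orb g 0 / pi); rewrite -/(orbit_ceil g).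
by rewrite ltr_pdivlMr// ler_pdivrMr// intrB.
Qed.

(** With n the value at h, the point h 0 lies in ](n - 1) pi, n pi], so its
    image under g lies in ]g 0 + (n - 1) pi, g 0 + n pi] by monotonicity and
    periodicity. *)
Lemma orbit_ceil_coboundary g h :
  coboundary orbit_ceil g h = 0 \/ coboundary orbit_ceil g h = 1.
Proof.
have /andP[g1 g2] := orbit_ceil_itv g.
have /andP[h1 h2] := orbit_ceil_itv h.
have /andP[c1 c2] := orbit_ceil_itv (g * h)%g.
set n := orbit_ceil h in h1 h2 *.
have base : orb g ((n%:~R - 1) * pi) = orb g 0 + (n%:~R - 1) * pi.
  have := orb_shift g 0 (n - 1); rewrite add0r intrB; exact.
have e : orb (g * h)%g 0 <= orb g 0 + n%:~R * pi /\
    orb g 0 + (n%:~R - 1) * pi < orb (g * h)%g 0.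
  rewrite orbM; have [hn|hn] := eqVneq (orb h 0) (n%:~R * pi).
    have := orb_shift g 0 n; rewrite add0r hn => ->; split=> //.
    by rewrite ltrD2l; lra.
  have [|] := andP (@orb_lt g ((n%:~R - 1) * pi) (orb h 0) _).
    apply/andP; split=> //; have : orb h 0 < n%:~R * pi by rewrite lt_neqAle hn.
    by lra.
  by rewrite base => e1 e2; split=> //; apply: ltW; lra.
case: e => e1 e2.
have u : ((orbit_ceil (g * h)%g)%:~R - 1) * pi < ((orbit_ceil g)%:~R + n%:~R) * pi :> R.
  by lra.
have v : ((orbit_ceil g)%:~R - 1 + n%:~R - 1) * pi < (orbit_ceil (g * h)%g)%:~R * pi :> R.
  by lra.
move: u v; rewrite !ltr_pM2r// /coboundary -/n.
rewrite -(intrD _ _ n) -[1]/(1%:~R) -!intrB -(intrD _ _ n) -intrB !ltr_int.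
by lia.
Qed.

Lemma orbit_ceil_near g : `|(orbit_ceil g)%:~R * pi - t g| <= 2 * pi.
Proof.
have := orb_near g 0; have /andP[] := orbit_ceil_itv g; rewrite subr0.
by rewrite ltr_norml ler_norml => ? ? /andP[? ?]; apply/andP; split; lra.
Qed.

(** w is the translation number of g. *)
Definition rotation g (w : R) := exists C : R, forall n, `|t (g ^+ n)%g - n%:R * w| <= C.

Lemma rotation_unique g w w' : rotation g w -> rotation g w' -> w = w'.
Proof.
move=> [C HC] [C' HC']; apply/eqP; rewrite -subr_eq0; apply/eqP.
apply: (@linear_bounded_eq0 _ _ (C' + C)) => n.
have -> : n%:R * (w - w') = (t (g ^+ n)%g - n%:R * w') - (t (g ^+ n)%g - n%:R * w) by ring.
by apply: (le_trans (ler_normB _ _)); apply: lerD.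
Qed.

Lemma angle1_lt : `|t 1%g| < pi / 2.
Proof.
have := cocycle_defect HM 1%g 1%g; rewrite mulg1 subrr sub0r normrN; exact.
Qed.

(** A real eigenvector is a point of the circle fixed by g, so above it g
    translates by a multiple of pi. *)
Lemma rotation_nonelliptic g : 4 <= tr (M g) ^+ 2 ->
  exists m : int, rotation g (m%:~R * pi).
Proof.
move=> /real_eigenvector[x [y [l [xy0 l0 _ ex ey]]]].
pose n := Num.sqrt (x ^+ 2 + y ^+ 2).
have n2 : n ^+ 2 = x ^+ 2 + y ^+ 2 by rewrite sqr_sqrtr// addr_ge0 ?sqr_ge0.
have n0 : n != 0 by rewrite -sqrf_eq0 n2.
have [p [px py]] : exists p, x / n = cos p /\ y / n = sin p.
  apply: polar_unit; rewrite !expr_div_n n2 -mulrDl divff//.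
have [q q0 [q1 q2]] := orb_acts g p.
have e1 : ma (M g) * cos p + mb (M g) * sin p = l * cos p.
  by rewrite -px -py !mulrA -mulrDl ex.
have e2 : mc (M g) * cos p + md (M g) * sin p = l * sin p.
  by rewrite -px -py !mulrA -mulrDl ey.
have : sin (orb g p - p) = 0.
  apply: (mulfI (lt0r_neq0 q0)); rewrite mulr0 sinB mulrBr !mulrA.
  by rewrite -q1 -q2 e1 e2; ring.
move=> /sin_eq0[m /eqP]; rewrite subr_eq addrC => /eqP om.
exists m, (pi / 2) => k.
have ok : orb (g ^+ k)%g p = p + k%:R * (m%:~R * pi).
  elim: k => [|k IH].
    rewrite expg0 mul0r addr0; apply: moves_unique; split.
      by rewrite subrr sub0r normrN angle1_lt.
    have [a1 a2 a3 a4] := @SL2_oneE R.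
    by exists 1 => //; rewrite (morph_group1 (cocycle_mx HM)) a1 a2 a3 a4; split; ring.
  rewrite expgS orbM IH.
  have -> : k%:R * (m%:~R * pi) = (k%:Z * m)%:~R * pi :> R.
    by rewrite intrM mulrA.
  by rewrite orb_shift om intrM -natr1 /=; ring.
have := orb_near (g ^+ k)%g p; rewrite ok => /ltW.
by rewrite -normrN; congr (`|_| <= _); ring.
Qed.

(** An elliptic matrix is cos w + J sin w with J^2 = -1, and its powers are
    cos (n w) + J sin (n w), with rotation part (2 cos (n w), j sin (n w)),
    where j = skew J.  If the sign of w is chosen so that j > 0, the angle of
    this vector stays within pi/2 of n w; since t (g^n) is an angle of the
    same vector, induction on n keeps it close to n w. *)
Lemma rotation_elliptic g : tr (M g) ^+ 2 < 4 -> exists w : R,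
  rotation g w /\ forall n, tr (M (g ^+ n)%g) = 2 * cos (n%:R * w).
Proof.
rewrite /tr => ell; have := tr_skew_split (M g); have := SL2_det (M g).
pose A := M g; rewrite -/A.
set a := ma A; set b := mb A; set c := mc A; set d := md A => det split.
have := sqr_ge0 (a - d); have := sqr_ge0 (b + c) => s1 s2.
have y2 : 0 < (c - b) ^+ 2.
  move: ell split; rewrite /tr /skew -/A -/a -/b -/c -/d; lra.
have y0 : c - b != 0 by rewrite -sqrf_eq0 lt0r_neq0.
pose s0 := Num.sqrt (1 - ((a + d) / 2) ^+ 2).
have s02 : s0 ^+ 2 = 1 - ((a + d) / 2) ^+ 2.
  by rewrite sqr_sqrtr// expr_div_n; move: ell; rewrite -/A -/a -/d; lra.
(* s is sin w, with the sign that makes j = (c - b) / s positive. *)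
pose s := Num.sg (c - b) * s0.
have s2E : s ^+ 2 = 1 - ((a + d) / 2) ^+ 2 by rewrite exprMn sqr_sg y0 mul1r.
have s2gt0 : 0 < s ^+ 2.
  by rewrite s2E expr_div_n; move: ell; rewrite -/A -/a -/d; lra.
have sn0 : s != 0 by rewrite -sqrf_eq0 lt0r_neq0.
have s0gt0 : 0 < s0.
  rewrite lt0r sqrtr_ge0 andbT; apply: contra_neq sn0 => h.
  by rewrite /s h mulr0.
pose j := (c - b) / s.
have j0 : 0 < j.
  rewrite -(pmulr_lgt0 _ s2gt0) /j expr2 mulrA divfK// /s mulrA.
  by rewrite [_ * Num.sg _]mulrC -normrEsg mulr_gt0// normr_gt0.
have [w0 [cw sw]] : exists w, (a + d) / 2 = cos w /\ s = sin w.
  by apply: polar_unit; rewrite s2E; ring.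
(* u, v, z and - u are the entries of J. *)
pose u := (a - d) / 2 / s; pose v := b / s; pose z := c / s.
have J2 : u ^+ 2 + v * z = - 1.
  have : s ^+ 2 * (u ^+ 2 + v * z) = - s ^+ 2.
    rewrite [in RHS]s2E /u /v /z.
    transitivity (((a - d) / 2) ^+ 2 + b * c); first by field.
    nra.
  by move=> e; apply: (mulfI (lt0r_neq0 s2gt0)); rewrite e mulrN1.
have rep w : cos w = (a + d) / 2 -> sin w = s -> forall n,
    [/\ ma (A ^+ n)%g = cos (n%:R * w) + sin (n%:R * w) * u,
        mb (A ^+ n)%g = sin (n%:R * w) * v,
        mc (A ^+ n)%g = sin (n%:R * w) * z &
        md (A ^+ n)%g = cos (n%:R * w) - sin (n%:R * w) * u].
  move=> {}cw {}sw; elim=> [|n [I1 I2 I3 I4]].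
    have [a1 a2 a3 a4] := @SL2_oneE R.
    by rewrite expg0 a1 a2 a3 a4 mul0r cos0 sin0 !mul0r addr0 subr0.
  have aE : a = cos w + sin w * u by rewrite cw sw /u; field.
  have dE : d = cos w - sin w * u by rewrite cw sw /u; field.
  have bE : b = sin w * v by rewrite sw /v; field.
  have cE : c = sin w * z by rewrite sw /z; field.
  have -> : n.+1%:R * w = w + n%:R * w by rewrite -natr1; ring.
  rewrite expgS !SL2_mulE I1 I2 I3 I4 -/a -/b -/c -/d aE bE cE dE cosD sinD.
  set C := cos w; set S := sin w; set C' := cos _; set S' := sin _.
  split; [|ring|ring|].
    transitivity (C * C' + (S * C' + C * S') * u + S * S' * (u ^+ 2 + v * z)); first by ring.
    by rewrite J2; ring.
  transitivity (C * C' - (S * C' + C * S') * u + S * S' * (u ^+ 2 + v * z)); first by ring.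
  by rewrite J2; ring.
have [r r0 [trE skewE]] := cocycle_polar HM g.
have near0 : 0 < cos (t g - w0).
  apply: (cos_gt0_stretch j0 r0).
    by rewrite -trE -cw /tr -/A -/a -/d; field.
  by rewrite -skewE -sw /skew -/A -/c -/b /j; field.
(* Among the angles w0 + 2 m pi, w is the one close to t g. *)
have [m wm] := cos_gt0_reduce near0.
pose w := w0 + 2 * m%:~R * pi.
have wm' : `|t g - w| < pi / 2.
  by rewrite (_ : t g - w = t g - w0 - 2 * m%:~R * pi)// /w; ring.
have cwE : cos w = cos w0.
  by rewrite -(cosB2intmul_pi w m) /w addrK.
have swE : sin w = sin w0.
  by rewrite -(sinB2intmul_pi w m) /w addrK.
have {}rep := rep w _ _.
exists w; split; last first.
  move=> n; rewrite (morph_groupX (cocycle_mx HM)).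
  have [||-> _ _ ->] := rep _ _ n; rewrite ?cwE ?swE//; ring.
exists (pi / 2) => n; apply: ltW; elim: n => [|n IH].
  by rewrite expg0 mul0r subr0 angle1_lt.
apply: cos_gt0_pihalfP.
  have -> : n.+1%:R * w = w + n%:R * w by rewrite -natr1; ring.
  have := cocycle_defect HM g (g ^+ n)%g; move: IH wm'; rewrite -expgS !ltr_norml.
  by move=> /andP[? ?] /andP[? ?] /andP[? ?]; apply/andP; split; lra.
have [q q0 [qx qy]] := cocycle_polar HM (g ^+ n.+1)%g.
have [||A1 A2 A3 A4] := rep _ _ n.+1; rewrite ?cwE ?swE//.
apply: (cos_gt0_stretch j0 q0).
  by rewrite -qx /tr (morph_groupX (cocycle_mx HM)) A1 A4; ring.
by rewrite -qy /skew (morph_groupX (cocycle_mx HM)) A2 A3 /j /v /z; field.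
Qed.

End rotation.

(** * Groups with a nonzero homomorphism to the reals *)

Lemma unit_defect_quasimorphism (L : groupType) (f : L -> int) :
  (forall g h, coboundary f g h = 0 \/ coboundary f g h = 1) ->
  f \in @quasimorphism_pred L.
Proof. by move=> h; apply/asboolP; exists 1 => g k; case: (h g k) => ->. Qed.

Definition unit_defect_QM (L : groupType) (f : L -> int)
    (hf : forall g h, coboundary f g h = 0 \/ coboundary f g h = 1) : QM L :=
  MkQM (unit_defect_quasimorphism hf).

Lemma homomorphism_expg (L : groupType) (u : L -> int) : is_homomorphism u ->
  forall g n, u (g ^+ n)%g = n%:Z * u g.
Proof.
move=> hu g; elim=> [|n IH].
  by have := hu 1%g 1%g; rewrite mulg1 expg0 mul0r; lia.
by rewrite expgS hu IH; lia.
Qed.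

Section real_homomorphism.
Context {R : realType} {L : groupType} {lam : L -> R}.
Hypothesis lamM : forall g h, lam (g * h)%g = lam g + lam h.
Implicit Types s : R.

Lemma ceil_hom_coboundary s g h :
  coboundary (fun g => Num.ceil (s * lam g)) g h = 0 \/
  coboundary (fun g => Num.ceil (s * lam g)) g h = 1.
Proof.
rewrite /coboundary lamM mulrDr.
have := ceil_itv (s * lam g); have := ceil_itv (s * lam h).
have := ceil_itv (s * lam g + s * lam h).
set x := s * lam g; set y := s * lam h.
set m := Num.ceil (x + y); set p := Num.ceil x; set q := Num.ceil y.
rewrite !intrB => /andP[m1 m2] /andP[q1 q2] /andP[p1 p2].
have : (m - 1)%:~R < (p + q)%:~R :> R by rewrite intrB intrD; lra.
have : (p - 1 + (q - 1))%:~R < m%:~R :> R by rewrite intrD !intrB; lra.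
by rewrite !ltr_int; lia.
Qed.

Definition ceil_hom s : QM L := unit_defect_QM (ceil_hom_coboundary s).

Let lamX g n : lam (g ^+ n)%g = n%:R * lam g.
Proof.
elim: n => [|n IH].
  by have := lamM 1%g 1%g; rewrite mulg1 expg0 mul0r; lra.
by rewrite expgS lamM IH -natr1; ring.
Qed.

(** On the powers of g, both sides grow linearly and remain at a bounded
    distance, so they have the same slope. *)
Lemma ceil_hom_integral (n : int) s s' (u : L -> int) (B : int) g :
  is_homomorphism u ->
  (forall g, `|n * (ceil_hom s g - ceil_hom s' g) - u g| <= B) ->
  n%:~R * (s - s') * lam g = (u g)%:~R.
Proof.
move=> hu hB; apply/eqP; rewrite -subr_eq0; apply/eqP.
apply: (@linear_bounded_eq0 _ _ (B%:~R + 2 * `|n%:~R|)) => k.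
have := hB (g ^+ k)%g; rewrite (homomorphism_expg hu) /= lamX.
have := ceil_itv (s * (k%:R * lam g)); have := ceil_itv (s' * (k%:R * lam g)).
set p := Num.ceil (s * _); set q := Num.ceil _.
rewrite !intrB -(ler_int R) intr_norm !(intrB, intrM).
move=> /andP[q1 q2] /andP[p1 p2] hb.
rewrite [k%:~R]/(k%:R) in hb.
set N : R := n%:~R in hb *.
have -> : k%:R * (N * (s - s') * lam g - (u g)%:~R) =
  (N * (p%:~R - q%:~R) - k%:R * (u g)%:~R) -
  N * ((p%:~R - s * (k%:R * lam g)) - (q%:~R - s' * (k%:R * lam g))) by ring.
apply: (le_trans (ler_normB _ _)); apply: lerD => //.
rewrite normrM mulrC ler_wpM2r// ler_norml; apply/andP; split; lra.
Qed.

(** The map ceil_hom s is a homomorphism only if s lam is integral, and equal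
    multiples of the classes of s and s' force (s - s') lam g0 to be rational:
    both relations have countably many solutions s. *)
Lemma real_homomorphism_independent g0 : lam g0 != 0 ->
  exists Lambda : set (QM L),
    [/\ forall rho, Lambda rho -> minimal_quasimorphism rho,
        ~ countable [set HQM_class rho | rho in Lambda]
      & Z_linearly_independent [set HQM_class rho | rho in Lambda]].
Proof.
move=> g00.
pose Z : set R := [set m%:~R / lam g0 | m in [set: int]].
have cZ : countable Z by apply: (sub_countable (card_image_le _ _)); exact: countableP.
apply: (@independent_HQM_classes L R (~` Z) ceil_hom).
- move=> cnZ; apply: (@uncountable_real R); rewrite -(setUv Z) -bigcup2E.
  by apply: bigcup_countable => // -[|[|k]] _ //=; exact: countable0.
- move=> s sZ; split; last exact: ceil_hom_coboundary.
  move=> hs; apply: sZ; exists (ceil_hom s g0) => //.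
  have := @ceil_hom_integral 1 s 0 (ceil_hom s) 0 g0 hs.
  rewrite subr0 mul1r => <-; first by rewrite mulfK.
  by move=> g; rewrite /= mul0r ceil0 subr0 mul1r subrr normr0.
- move=> n v n0.
  set F := [set _ | _]; have [->|/set0P[s [_ sv]]] := eqVneq F set0.
    exact: countable0.
  pose Y : set R := [set s - m%:~R / (n%:~R * lam g0) | m in [set: int]].
  have cY : countable Y by apply: (sub_countable (card_image_le _ _)); exact: countableP.
  apply: sub_countable cY; apply: subset_card_le => s' [_ s'v].
  have [u hu [B hB]] := HQM_class_eq_mulrz (etrans sv (esym s'v)).
  exists (u g0) => //; rewrite -(ceil_hom_integral g0 hu hB).
  have nR : n%:~R != 0 :> R by rewrite intr_eq0.
  by field; rewrite nR g00.
Qed.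

End real_homomorphism.

(** * Representations without elliptic elements *)

Section SL2_traces.
Context {R : realType}.
Implicit Types A B : SL2 R.

Lemma tr2_tr A : tr2 (\pi_(PSL2 R) A) = tr A ^+ 2.
Proof. by rewrite tr2_pi SL2_trE. Qed.

Definition commut A B : SL2 R := (A * B * A^-1 * B^-1)%g.

(** Fricke's identity expresses tr [X, Y] through tr X, tr Y and tr (X Y);
    applied to X = A and Y = [A, B], it shows that 2 - tr [A, .] changes sign
    under iteration when it is small and (tr A)^2 > 4. *)
Lemma tr_commut_iter A B : 2 - tr (commut A (commut A B)) =
  - (2 - tr (commut A B)) * (tr A ^+ 2 - 4 + (2 - tr (commut A B))).
Proof.
have fricke X Y : tr (commut X Y) =
    tr X ^+ 2 + tr Y ^+ 2 + tr (X * Y)%g ^+ 2 - tr X * tr Y * tr (X * Y)%g - 2.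
  have [x1 x2 x3 x4] := SL2_invE X; have [y1 y2 y3 y4] := SL2_invE Y.
  rewrite /commut /tr !SL2_mulE x1 x2 x3 x4 y1 y2 y3 y4.
  have := SL2_det X; have := SL2_det Y.
  set a := ma X; set b := mb X; set c := mc X; set d := md X.
  set e := ma Y; set f := mb Y; set g := mc Y; set h := md Y => dY dX.
  transitivity ((a + d) ^+ 2 * (e * h - f * g) + (e + h) ^+ 2 * (a * d - b * c) +
    (a * e + b * g + (c * f + d * h)) ^+ 2 -
    (a + d) * (e + h) * (a * e + b * g + (c * f + d * h)) -
    2 * (a * d - b * c) * (e * h - f * g)); first by ring.
  by rewrite dX dY; ring.
have trAC : tr (A * commut A B)%g = tr A * (tr (commut A B) - 1).
  have [x1 x2 x3 x4] := SL2_invE A; have [y1 y2 y3 y4] := SL2_invE B.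
  rewrite /commut /tr !SL2_mulE x1 x2 x3 x4 y1 y2 y3 y4.
  have := SL2_det A; have := SL2_det B.
  set a := ma A; set b := mb A; set c := mc A; set d := md A.
  set e := ma B; set f := mb B; set g := mc B; set h := md B => dB dA.
  set P := (X in _ = _ * (X - 1)).
  transitivity ((a + d) * P - (a * d - b * c) * (a + d) * (e * h - f * g)).
    by rewrite /P; ring.
  by rewrite dA dB; ring.
by rewrite (fricke A (commut A B)) trAC; ring.
Qed.

(** The eigenspace of A through (x, y) is a line, since A is not a scalar
    matrix; as B commutes with A, it preserves this line. *)
Lemma commuting_eigenvector A B (x y l : R) : tr A ^+ 2 != 4 -> (A * B = B * A)%g ->
  x ^+ 2 + y ^+ 2 != 0 -> ma A * x + mb A * y = l * x -> mc A * x + md A * y = l * y ->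
  exists k, ma B * x + mb B * y = k * x /\ mc B * x + md B * y = k * y.
Proof.
move=> tA AB xy0 e1 e2.
set w1 := ma B * x + _; set w2 := mc B * x + _.
have f1 : ma A * w1 + mb A * w2 = l * w1.
  transitivity (ma (A * B)%g * x + mb (A * B)%g * y).
    by rewrite !SL2_mulE /w1 /w2; ring.
  rewrite AB; transitivity (ma B * (ma A * x + mb A * y) + mb B * (mc A * x + md A * y)).
    by rewrite !SL2_mulE; ring.
  by rewrite e1 e2 /w1; ring.
have f2 : mc A * w1 + md A * w2 = l * w2.
  transitivity (mc (A * B)%g * x + md (A * B)%g * y).
    by rewrite !SL2_mulE /w1 /w2; ring.
  rewrite AB; transitivity (mc B * (ma A * x + mb A * y) + md B * (mc A * x + md A * y)).
    by rewrite !SL2_mulE; ring.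
  by rewrite e1 e2 /w2; ring.
have det := SL2_det A.
have [cr|cr] := eqVneq (x * w2 - y * w1) 0.
  exists ((x * w1 + y * w2) / (x ^+ 2 + y ^+ 2)); split.
    apply: (mulfI xy0); transitivity (x * (x * w1 + y * w2) - y * (x * w2 - y * w1)).
      by ring.
    by rewrite cr; field.
  apply: (mulfI xy0); transitivity (y * (x * w1 + y * w2) + x * (x * w2 - y * w1)).
    by ring.
  by rewrite cr; field.
exfalso; move/eqP: tA; apply; rewrite /tr.
have aE : ma A = l.
  apply/eqP; rewrite -subr_eq0; apply/eqP/(mulIf cr); rewrite mul0r.
  transitivity (w2 * (ma A * x + mb A * y - l * x) - y * (ma A * w1 + mb A * w2 - l * w1)).
    by ring.
  by rewrite e1 f1; ring.
have bE : mb A = 0.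
  apply: (mulIf cr); rewrite mul0r.
  transitivity (x * (ma A * w1 + mb A * w2 - l * w1) - w1 * (ma A * x + mb A * y - l * x)).
    by ring.
  by rewrite e1 f1; ring.
have dE : md A = l.
  apply/eqP; rewrite -subr_eq0; apply/eqP/(mulIf cr); rewrite mul0r.
  transitivity (x * (mc A * w1 + md A * w2 - l * w2) - w1 * (mc A * x + md A * y - l * y)).
    by ring.
  by rewrite e2 f2; ring.
move: det; rewrite aE bE dE mul0r subr0 => ll.
by transitivity (4 * (l * l)); [ring|rewrite ll mulr1].
Qed.

Lemma tr_commut_continuous A : continuous (fun B => tr (commut A B)).
Proof.
have c2 (f g : SL2 R -> SL2 R) : continuous f -> continuous g ->
    continuous (fun B => (f B * g B)%g).
  move=> cf cg B; apply: (@continuous_comp _ _ _ (fun B => (f B, g B)) (fun x => SL2_mul x.1 x.2)).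
    apply: (@cvg_pair_to _ _ _ (nbhs B) f g (f B) (g B)).
    - exact: cf.
    - exact: cg.
  exact: SL2_mul_continuous.
have cc : continuous (commut A).
  apply: (c2 (fun B => A * B * A^-1)%g (fun B => B^-1)%g); last exact: SL2_inv_continuous.
  apply: (c2 (fun B => A * B)%g (fun=> A^-1)%g); last exact: cst_continuous.
  by apply: (c2 (fun=> A) id) => B; [exact: cst_continuous|exact: cvg_id].
have ce i j : continuous (fun B => SL2_val (commut A B) i j).
  move=> B; apply: (@continuous_comp _ _ _ (commut A) (fun A => SL2_val A i j)).
    exact: cc.
  exact: SL2_entry_continuous.
by move=> B; apply: continuousD; exact: ce.
Qed.

Lemma tr_commutN A B : tr (commut A (SL2_opp B)) = tr (commut A B).
Proof.
have [y1 y2 y3 y4] := SL2_invE B; have [z1 z2 z3 z4] := SL2_invE (SL2_opp B).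
by rewrite /tr /commut !SL2_mulE y1 y2 y3 y4 z1 z2 z3 z4 !SL2_oppE; ring.
Qed.

End SL2_traces.

Lemma sqr_ge4 (R : realType) (x : R) : 4 <= x ^+ 2 -> ~ (-2 < x < 2).
Proof. by move=> x4 /andP[x1 x2]; nra. Qed.

Section no_elliptic.
Context {R : realType} {L : groupType} (rho : {multiplicative L -> PSL2 R}).
Context (M : L -> SL2 R).
Hypothesis MM : {morph M : g h / (g * h)%g}.
Hypothesis piM : forall g, \pi_(PSL2 R) (M g) = rho g.
Hypothesis rho_indiscrete : indiscrete rho.
Hypothesis rho_inj : injective rho.
Hypothesis rho_parabolic_free : parabolic_free rho.
Hypothesis rho_no_elliptic : forall g, 4 <= tr (M g) ^+ 2.

Let M1 : M 1%g = 1%g := morph_group1 MM.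
Let MV g : M (g^-1)%g = ((M g)^-1)%g := morph_groupV MM g.

Let tr_eq4 g : tr (M g) ^+ 2 = 4 -> g = 1%g.
Proof.
move=> t4; apply: rho_inj; rewrite (morph_group1 (gmulfM (s := rho))); apply: rho_parabolic_free.
by rewrite /parabolic -piM tr2_tr.
Qed.

Let tr_gt4 g : g <> 1%g -> 4 < tr (M g) ^+ 2.
Proof.
move=> g1; rewrite lt_neqAle rho_no_elliptic andbT.
by apply/eqP => t4; apply/g1/tr_eq4.
Qed.

(** A point of the image that is not isolated is moved to 1 by translation. *)
Lemma indiscrete_near1 (U : set (PSL2 R)) : nbhs (1%g : PSL2 R) U ->
  exists2 g, g <> 1%g & U (rho g).
Proof.
move=> nU; have [[g g1 Ug]|H] := pselect (exists2 g, g <> 1%g & U (rho g)).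
  by exists g.
exfalso; apply: rho_indiscrete => _ [g _ <-].
split; first by rewrite inE; exists g.
exists [set z | U (z * (rho g)^-1)%g].
  have c : {for rho g, continuous (fun z : PSL2 R => (z * (rho g)^-1)%g)}.
    apply: (@continuous_comp _ _ _ (fun z : PSL2 R => (z, (rho g)^-1)%g)
      (fun x : PSL2 R * PSL2 R => (x.1 * x.2)%g)); last exact: mulg_continuous.
    apply: (@cvg_pair_to _ _ _ (nbhs (rho g)) id (fun=> (rho g)^-1)%g);
      by [exact: cvg_id|exact: cvg_cst].
  by apply: c; rewrite mulgV.
apply/seteqP; split=> [z [/= Uz [h _ hz]]|_ ->]; last first.
  by split; [rewrite /= mulgV; exact: nbhs_singleton|exists g].
rewrite -{}hz in Uz *; have [hg|hg] := pselect (h = g); first by rewrite hg.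
exfalso; apply: H; exists (h * g^-1)%g.
  by move=> /(congr1 (fun x => x * g)%g); rewrite mulgVK mul1g.
by rewrite gmulfM (morph_groupV (gmulfM (s := rho))).
Qed.

(** For g close to 1, q = 2 - tr [h, g] is close to 0.  If q > 0 then [h, g]
    is elliptic; if q < 0 then [h, [h, g]] is elliptic by [tr_commut_iter].
    Hence q = 0, so [h, g] has trace 2 and is trivial. *)
Lemma commutes_near1 h : h <> 1%g -> \forall z \near (1%g : PSL2 R),
  forall g, rho g = z -> (h * g = g * h)%g.
Proof.
move=> h1; pose D := tr (M h) ^+ 2 - 4; have D0 : 0 < D by rewrite subr_gt0 tr_gt4.
pose F (z : PSL2 R) := tr (commut (M h) (repr z)).
have FE A : F (\pi_(PSL2 R) A) = tr (commut (M h) A).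
  by rewrite /F; case: (repr_PSL2 A) => ->; rewrite ?tr_commutN.
have cF : continuous F.
  apply: (@PSL2_invariant_continuous R (fun B => tr (commut (M h) B))).
    exact: tr_commut_continuous.
  exact: tr_commutN.
have F1 : F 1%g = 2.
  have -> : (1%g : PSL2 R) = \pi_(PSL2 R) (1%g) by [].
  rewrite FE /commut mulg1 mulgV mul1g invg1 /tr.
  by have [-> _ _ ->] := @SL2_oneE R.
have Fb : F z @[z --> (1%g : PSL2 R)] --> (2 : R) by rewrite -F1; exact: cF.
near=> z => g gz.
pose q := 2 - tr (M (h * g * h^-1 * g^-1)%g).
have qE : q = 2 - F z.
  by rewrite -gz -piM FE /q /commut !MM !MV.
have tC : tr (M (h * g * h^-1 * g^-1)%g) = 2 - q by rewrite /q; ring.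
have tCC : tr (commut (M h) (commut (M h) (M g))) = 2 + q * (D + q).
  have := tr_commut_iter (M h) (M g).
  have -> : tr (commut (M h) (M g)) = 2 - q by rewrite -tC /commut !MM !MV.
  rewrite -/D => e; rewrite -[LHS](subKr 2) e; ring.
have q4 : q < 4.
  have : -2 < F z by near: z; apply: (cvgr_gt _ Fb); lra.
  by rewrite qE; lra.
have qD : - D < q.
  have : F z < 2 + D by near: z; apply: (cvgr_lt _ Fb); lra.
  by rewrite qE; lra.
have qD' : - (4 / D) < q.
  have : F z < 2 + 4 / D.
    by near: z; apply: (cvgr_lt _ Fb); rewrite ltrDl divr_gt0.
  by rewrite qE; lra.
have {}qD' : - 4 < q * D.
  by move: qD'; rewrite -mulNr ltr_pdivrMr.
have q0 : q = 0.
  apply/eqP; rewrite -[_ == _]negbK neq_lt negb_or -!leNgt; apply/andP; split.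
    rewrite leNgt; apply/negP => qn.
    have := rho_no_elliptic (h * (h * g * h^-1 * g^-1) * h^-1 * (h * g * h^-1 * g^-1)^-1)%g.
    have -> : M (h * (h * g * h^-1 * g^-1) * h^-1 * (h * g * h^-1 * g^-1)^-1)%g =
      commut (M h) (commut (M h) (M g)) by rewrite /commut !(MM, MV).
    rewrite tCC => /sqr_ge4; apply; apply/andP; split.
      by have := sqr_ge0 q; rewrite mulrDr -expr2; lra.
    by rewrite gtrDl nmulr_rlt0//; lra.
  rewrite leNgt; apply/negP => qp.
  have := rho_no_elliptic (h * g * h^-1 * g^-1)%g; rewrite tC => /sqr_ge4; apply; lra.
have : (h * g * h^-1 * g^-1)%g = 1%g by apply: tr_eq4; rewrite tC q0; ring.
move=> /(congr1 (fun x => x * g * h)%g).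
by rewrite mul1g !mulgVK.
Unshelve. all: by end_near.
Qed.

(** For each g there is T <> 1, close enough to 1 to commute with h0 and with
    g.  An eigenvector of h0 is then one of T, and therefore one of g. *)
Lemma common_eigenvector h0 : h0 <> 1%g -> exists x y l : R,
  [/\ x ^+ 2 + y ^+ 2 != 0, l + l^-1 = tr (M h0), l != 0,
      ma (M h0) * x + mb (M h0) * y = l * x /\
      mc (M h0) * x + md (M h0) * y = l * y &
      forall g, exists k, ma (M g) * x + mb (M g) * y = k * x /\
                          mc (M g) * x + md (M g) * y = k * y].
Proof.
move=> h01.
have [x [y [l [xy0 l0 lV e1 e2]]]] := real_eigenvector (rho_no_elliptic h0).
exists x, y, l; split=> // g.
have [->|g1] := pselect (g = 1%g).
  have [a b c d] := @SL2_oneE R.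
  by exists 1; rewrite M1 a b c d; split; ring.
have [T T1 [/(_ T erefl) hT /(_ T erefl) gT]] := indiscrete_near1
  (filterI (commutes_near1 h01) (commutes_near1 g1)).
have n4 u : u <> 1%g -> tr (M u) ^+ 2 != 4.
  by move=> u1; apply/eqP => /tr_eq4.
have [m [m1 m2]] := commuting_eigenvector (n4 _ h01)
  (etrans (esym (MM h0 T)) (etrans (congr1 M hT) (MM T h0))) xy0 e1 e2.
exact: (commuting_eigenvector (n4 _ T1)
  (etrans (esym (MM T g)) (etrans (congr1 M (esym gT)) (MM g T))) xy0 m1 m2).
Qed.

Lemma no_elliptic_real_homomorphism : exists2 lam : L -> R,
  forall g h, lam (g * h)%g = lam g + lam h & exists g, lam g != 0.
Proof.
have [h0 h01 _] := indiscrete_near1 filterT.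
have [x [y [l [xy0 lV l0 [e1 e2] /choice[chi chiE]]]]] := common_eigenvector h01.
have inj (a b : R) : a * x = b * x -> a * y = b * y -> a = b.
  move=> ax ay; apply: (mulIf xy0); rewrite !mulrDr !expr2 !mulrA ax ay; ring.
have chiM g h : chi (g * h)%g = chi g * chi h.
  have [g1 g2] := chiE g; have [h1 h2] := chiE h; have [gh1 gh2] := chiE (g * h)%g.
  apply: inj.
    rewrite -gh1 MM !SL2_mulE.
    transitivity (ma (M g) * (ma (M h) * x + mb (M h) * y) +
      mb (M g) * (mc (M h) * x + md (M h) * y)); first by ring.
    rewrite h1 h2; transitivity (chi h * (ma (M g) * x + mb (M g) * y)); first by ring.
    by rewrite g1; ring.
  rewrite -gh2 MM !SL2_mulE.
  transitivity (mc (M g) * (ma (M h) * x + mb (M h) * y) +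
    md (M g) * (mc (M h) * x + md (M h) * y)); first by ring.
  rewrite h1 h2; transitivity (chi h * (mc (M g) * x + md (M g) * y)); first by ring.
  by rewrite g2; ring.
have chi1 : chi 1%g = 1.
  have [a b c d] := @SL2_oneE R.
  by have [] := chiE 1%g; rewrite M1 a b c d => u v; apply: inj; rewrite -?u -?v; ring.
have chi0 g : chi g != 0.
  apply/eqP => g0; have := chiM g (g^-1)%g; rewrite mulgV chi1 g0 mul0r => /eqP.
  by rewrite oner_eq0.
exists (fun g => ln `|chi g|) => [g h|].
  by rewrite chiM normrM lnM// posrE normr_gt0.
exists h0; have chil : chi h0 = l.
  by have [u v] := chiE h0; apply: inj; [rewrite -u|rewrite -v].
rewrite ln_eq0 ?normr_gt0// chil; apply/eqP => l1.
have := tr_gt4 h01; rewrite -lV.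
have ll : l * l = 1 by rewrite -expr2 -real_normK ?num_real// l1 expr1n.
have -> : l^-1 = l by apply: (mulfI l0); rewrite divff.
by nra.
Qed.

End no_elliptic.

(** * Representations with elliptic elements *)

Section elliptic_classes.
Context {R : realType} {L : groupType}.
Implicit Types (rho lambda : {multiplicative L -> PSL2 R}).

Lemma liftable_cocycle rho : liftable rho -> exists M t,
  polar_cocycle M t /\ forall g, \pi_(PSL2 R) (M g) = rho g.
Proof.
move=> [r rE]; exists (fun g => cover_mx (r g)), (fun g => angle (r g)).
split=> [|g]; last by rewrite pi_cover_mx rE.
split=> [g h|g|g h].
- by rewrite gmulfM cover_mxM.
- exact: cover_mx_polar.
- by rewrite gmulfM; exact: angle_defect.
Qed.

Section one_representation.
Context {M : L -> SL2 R} {t : L -> R}.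
Hypothesis HM : polar_cocycle M t.

Definition ceil_QM : QM L := unit_defect_QM (orbit_ceil_coboundary HM).

Lemma ceil_QM_near g : `|(ceil_QM g)%:~R * pi - t g| <= 2 * pi.
Proof. exact: orbit_ceil_near. Qed.

Lemma elliptic_rotation_nonintegral g w : tr (M g) ^+ 2 < 4 ->
  rotation (t := t) g w -> forall m : int, w != m%:~R * pi.
Proof.
move=> ell rw m; apply/eqP => wm.
have [w' [rw' tE]] := rotation_elliptic HM ell.
have ww : w' = w by exact: rotation_unique rw' rw.
move: ell; have := tE 1%N; rewrite expg1 mul1r => ->.
have := cos2Dsin2 w'; rewrite ww wm sin_intmul_pi exprMn => ?; lra.
Qed.

(** If g^n = 1, then t is bounded on the powers of g, so the translation
    number is 0 and the trace is 2. *)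
Lemma elliptic_expg_neq1 g n : tr (M g) ^+ 2 < 4 -> (0 < n)%N -> (g ^+ n)%g <> 1%g.
Proof.
move=> ell n0 gn; have [w [[C HC] tE]] := rotation_elliptic HM ell.
suff w0 : w = 0.
  by move: ell; have := tE 1%N; rewrite expg1 w0 mulr0 cos0 => ->; lra.
have n0' : n%:R != 0 :> R by rewrite pnatr_eq0 -lt0n.
apply: (mulfI n0'); rewrite mulr0; apply: (@linear_bounded_eq0 _ _ (C + `|t 1%g|)) => k.
have := HC (n * k)%N; rewrite expgnA gn expg1n natrM => h.
have -> : k%:R * (n%:R * w) = t 1%g - (t 1%g - n%:R * k%:R * w) by ring.
by rewrite [C + _]addrC; apply: (le_trans (ler_normB _ _)); rewrite lerD.
Qed.

(** If it were a homomorphism, its value at g would be the translation number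
    of g divided by pi, which is no integer for an elliptic g. *)
Lemma ceil_QM_minimal g : tr (M g) ^+ 2 < 4 -> minimal_quasimorphism ceil_QM.
Proof.
move=> ell; split; last exact: orbit_ceil_coboundary.
move=> hom; have := @elliptic_rotation_nonintegral g ((ceil_QM g)%:~R * pi) ell.
move=> /(_ _ (ceil_QM g))/eqP; apply=> //; exists (2 * pi) => k.
have := ceil_QM_near (g ^+ k)%g.
by rewrite (homomorphism_expg hom) intrM distrC -mulrA.
Qed.

End one_representation.

(** Equal multiples force n w1 - n w2 to be a multiple of pi, where w1 and w2
    are the translation numbers of g.  If lambda g is elliptic, g^|n| has the
    same squared trace 4 cos^2 (n w1) for rho and lambda, although it has
    infinite order.  Otherwise w2, and thus n w1, is a multiple of pi, so that
    rho (g^|n|) is parabolic or trivial, and g^|n| = 1. *)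
Lemma distinct_classes rho lambda M t N s (HM : polar_cocycle M t)
    (HN : polar_cocycle N s) g (n : int) :
  (forall g, \pi_(PSL2 R) (M g) = rho g) ->
  (forall g, \pi_(PSL2 R) (N g) = lambda g) ->
  injective rho -> parabolic_free rho ->
  (fun g => tr2 (rho g)) @` (~` @torsion L) `&`
    (fun g => tr2 (lambda g)) @` (~` @torsion L) = set0 ->
  tr (M g) ^+ 2 < 4 -> n != 0 ->
  HQM_class (ceil_QM HM) *~ n <> HQM_class (ceil_QM HN) *~ n.
Proof.
move=> piM piN rho_inj pfree disj ell n0 /HQM_class_eq_mulrz[u hu [B hB]].
have p0 := pi_gt0 R.
have [w1 [rw1 t1E]] := rotation_elliptic HM ell.
have relation w2 : rotation (t := s) g w2 -> n%:~R * w1 = n%:~R * w2 + (u g)%:~R * pi.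
  move: rw1 => [C1 HC1] [C2 HC2]; apply/eqP; rewrite -subr_eq0; apply/eqP.
  apply: (@linear_bounded_eq0 _ _ (B%:~R * pi + `|n%:~R| * (2 * pi + C1 + (2 * pi + C2)))) => k.
  have := hB (g ^+ k)%g; rewrite (homomorphism_expg hu) -(ler_int R) intr_norm !(intrB, intrM).
  have := ceil_QM_near HM (g ^+ k)%g; have := ceil_QM_near HN (g ^+ k)%g.
  have := HC1 k; have := HC2 k; rewrite [k%:~R]/(k%:R).
  set T := t _; set S := s _; set f1 : R := (ceil_QM HM _)%:~R; set f2 : R := (ceil_QM HN _)%:~R.
  set nn : R := n%:~R; set U : R := (u g)%:~R; set K : R := k%:R.
  move=> hS hT h2 h1 hb.
  have -> : K * (nn * w1 - (nn * w2 + U * pi)) =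
    (nn * (f1 - f2) - K * U) * pi -
    nn * ((f1 * pi - T) + (T - K * w1) - ((f2 * pi - S) + (S - K * w2))) by ring.
  apply: (le_trans (ler_normB _ _)); apply: lerD.
    by rewrite normrM (gtr0_norm p0) ler_wpM2r// ltW.
  rewrite normrM ler_wpM2l//; apply: (le_trans (ler_normB _ _)).
  by apply: lerD; apply: (le_trans (ler_normD _ _)); apply: lerD.
pose k := `|n|%N; have k0 : (0 < k)%N by rewrite absz_gt0.
have cosk w2 : rotation (t := s) g w2 -> cos (k%:R * w1) ^+ 2 = cos (k%:R * w2) ^+ 2.
  move=> /relation e.
  have cosn w : cos (k%:R * w) ^+ 2 = cos (n%:~R * w) ^+ 2.
    rewrite /k; case: n {n0 hB relation e k k0} => m //=.
    by rewrite NegzE mulrNz mulNr cosN.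
  by rewrite !cosn e cos_sqr_shift.
have gk m : (0 < m)%N -> ((g ^+ k) ^+ m)%g <> 1%g.
  by move=> m0; rewrite -expgnA; apply: (elliptic_expg_neq1 HM ell); rewrite muln_gt0 k0.
have trM : tr (M (g ^+ k)%g) ^+ 2 = 4 * cos (k%:R * w1) ^+ 2.
  by rewrite t1E exprMn; congr (_ * _); ring.
have [ell2|nell2] := ltP (tr (N g) ^+ 2) 4.
  have [w2 [rw2 t2E]] := rotation_elliptic HN ell2.
  have ntor : (~` @torsion L) (g ^+ k)%g by move=> [m m0 /gk]; exact.
  have : set0 (tr2 (rho (g ^+ k)%g)).
    rewrite -disj; split; exists (g ^+ k)%g => //.
    rewrite -piN -piM !tr2_tr trM (cosk w2 rw2) t2E exprMn; congr (_ * _); ring.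
  by [].
have [m rm] := rotation_nonelliptic HN nell2.
have t4 : tr (M (g ^+ k)%g) ^+ 2 = 4.
  rewrite trM (cosk _ rm) [k%:R * (_ * pi)]mulrA (_ : k%:R * m%:~R = (k%:Z * m)%:~R); last by rewrite intrM.
  by rewrite -[_ * pi]add0r cos_sqr_shift cos0 expr1n mulr1.
apply: (@gk 1%N isT); rewrite expg1; apply: rho_inj; rewrite (morph_group1 (gmulfM (s := rho))).
by apply: pfree; rewrite /parabolic -piM tr2_tr.
Qed.

End elliptic_classes.

Theorem corollary1p12 (R : realType) (L : groupType)
    (hL : liftable_flexible R L) :
  exists Lambda : set (QM L),
    [/\ forall rho, Lambda rho -> minimal_quasimorphism rho,
        ~ countable [set HQM_class rho | rho in Lambda]
      & Z_linearly_independent [set HQM_class rho | rho in Lambda]].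
Proof.
case: hL => _ [Lam [unc disj HLam]].
have [[rho Lrho noell]|ell] :=
    pselect (exists2 rho, Lam rho & forall g, 4 <= tr2 (rho g)).
  have [ind inj pfree /liftable_cocycle[M [t [HM piM]]]] := HLam _ Lrho.
  have [] := @no_elliptic_real_homomorphism R L rho M (cocycle_mx HM) piM ind inj pfree.
    by move=> g; rewrite -tr2_tr piM.
  by move=> lam lamM [g]; exact: real_homomorphism_independent.
have {}ell rho : Lam rho -> exists g, tr2 (rho g) < 4.
  move=> Lrho; apply: contrapT => ne; apply: ell; exists rho => // g.
  by rewrite leNgt; apply/negP => gl; apply: ne; exists g.
have /choice[al alE] : forall rho, exists f : QM L, Lam rho ->
    exists M t (HM : polar_cocycle M t),
      (forall g, \pi_(PSL2 R) (M g) = rho g) /\ f = ceil_QM HM.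
  move=> rho; have [Lrho|nLrho] := pselect (Lam rho); last by exists 0.
  have [_ _ _ /liftable_cocycle[M [t [HM piM]]]] := HLam _ Lrho.
  by exists (ceil_QM HM) => _; exists M, t, HM.
apply: (independent_HQM_classes (I := Lam) (al := al)) => //.
  move=> rho Lrho; have [M [t [HM [piM ->]]]] := alE _ Lrho.
  have [g gell] := ell _ Lrho.
  by apply: (ceil_QM_minimal HM (g := g)); rewrite -tr2_tr piM.
move=> n v n0; set F := [set _ | _].
have [->|/set0P[rho [Lrho rv]]] := eqVneq F set0; first exact: countable0.
apply: (@sub_countable _ _ _ [set rho]); last exact: countable1.
apply: subset_card_le => lam [Llam lv]; apply: contrapT => lr.
have [M [t [HM [piM alr]]]] := alE _ Lrho.
have [N [s [HN [piN all]]]] := alE _ Llam.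
have [_ inj pfree _] := HLam _ Lrho.
have [g gell] := ell _ Lrho.
apply: (distinct_classes (HM := HM) (HN := HN) piM piN inj pfree _ _ n0).
- by apply: disj => // rl; apply: lr.
- by rewrite -tr2_tr piM; exact: gell.
- by rewrite -alr -all rv lv.
Qed.
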